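(* Let $p,q$ be relatively prime integers with $q>0$ and let $\varphi(z)=ze^{i\frac{2p}{q}\pi}$. Let $\psi\in C(\mathbb{T})$ be a function that is not one-to-one on $\mathbb{T}$, such that $T_\psi$ is irreducible, $\varphi(\psi(\mathbb{T}))=\psi(\mathbb{T})$, and $$\psi(\mathbb{T})=\mathbb{T}\cup\bigcup_{n=0}^{q-1}\varphi^n([1/2,1)).$$ Then the $C^*$-algebras $C(\psi(\mathbb{T}))\rtimes_\varphi\mathbb{Z}$ and $C(\mathbb{T})\rtimes_\varphi\mathbb{Z}$ are not isomorphic.
   Context: $\mathbb{T}$ is the unit circle in $\mathbb{C}$, and $[1/2,1)$ is the real interval regarded as a subset of $\mathbb{C}$. $T_\psi g=P_{H^2}(\psi g)$ is the Toeplitz operator with symbol $\psi$ on the Hardy space $H^2$; it is irreducible if its only closed reducing subspaces are $0$ and $H^2$. For $X=\psi(\mathbb{T})$ or $X=\mathbb{T}$, $C(X)\rtimes_\varphi\mathbb{Z}$ is the crossed product for the action $\alpha_n(f)(x)=f(\varphi^{-n}(x))$, $n\in\mathbb{Z}$, $f\in C(X)$, $x\in X$, where $\varphi^n$ is the $n$-th iterate of $\varphi$. *)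

(* Defs.v *)
From HB Require Import structures.
From mathcomp Require Import all_boot all_order all_algebra.
From mathcomp Require Import complex.
From mathcomp Require Import all_classical all_reals all_analysis.
Set Implicit Arguments.
Unset Strict Implicit.
Unset Printing Implicit Defensive.
Import Order.TTheory GRing.Theory Num.Theory.
Import numFieldNormedType.Exports.
Local Open Scope classical_set_scope.
Local Open Scope ring_scope.

(* The library puts the norm topology on the alias R[i]^o only. *)
HB.instance Definition _ (R : realType) := NormedModule.copy R[i] R[i]^o.

(** * C*-algebras *)

(* All C*-algebras below are unital.  The norm is a plain real-valued function
   because the hierarchy has no join of GRing.Algebra with the normed modules;
   completeness is therefore spelled out with Cauchy sequences. *)
HB.mixin Record isCstar (R : realType) A of GRing.Algebra R[i] A := {
  star : A -> A;
  cnorm : A -> R;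
  starD : forall a b, star (a + b) = star a + star b;
  starZ : forall c a, star (c *: a) = conjc c *: star a;
  starM : forall a b, star (a * b) = star b * star a;
  starK : forall a, star (star a) = a;
  cnorm_eq0 : forall a, cnorm a = 0 -> a = 0;
  cnormZ : forall c a, cnorm (c *: a) = complex.Re `|c| * cnorm a;
  cnormD : forall a b, cnorm (a + b) <= cnorm a + cnorm b;
  cnormM : forall a b, cnorm (a * b) <= cnorm a * cnorm b;
  cnorm_star : forall a, cnorm (star a * a) = cnorm a ^+ 2;
  cnorm_complete : forall u : nat -> A,
    (forall e : R, 0 < e -> exists N : nat, forall m n : nat,
      (N <= m)%N -> (N <= n)%N -> cnorm (u m - u n) < e) ->
    exists l : A, cnorm (u n - l) @[n --> \oo] --> (0 : R) }.

#[short(type="cstarAlgType")]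
HB.structure Definition CstarAlgebra (R : realType) :=
  {A of isCstar R A & GRing.Algebra R[i] A}.

Definition star_hom (R : realType) (A B : cstarAlgType R) (f : A -> B) : Prop :=
  [/\ linear f, monoid_morphism f & forall a, f (star a) = star (f a)].

Definition cstar_isomorphic (R : realType) (A B : cstarAlgType R) : Prop :=
  exists f : A -> B, star_hom f /\ bijective f.

(** * The *-algebra C(X) *)

Section ContinuousFunctions.
Context {R : realType} {X : topologicalType}.
Local Notation CX := (continuousType X R[i]).
Implicit Types f g h : CX.

Let cts_add f g : continuous (fun x => f x + g x).
Proof. by move=> x; apply: cvgD; exact: cts_fun. Qed.
Let cts_opp f : continuous (fun x => - f x).
Proof. by move=> x; apply: cvgN; exact: cts_fun. Qed.
Let cts_mul f g : continuous (fun x => f x * g x).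
Proof. by move=> x; apply: cvgM; exact: cts_fun. Qed.
Let cts_conj f : continuous (fun x => conjc (f x)).
Proof.
move=> x; apply: (@continuous_comp _ _ _ f (@conjc R)); first exact: cts_fun.
move=> B /nbhs_ballP[e e0 eB]; apply/nbhs_ballP; exists e => // z.
rewrite -ball_normE /= => ze; apply: eB.
by rewrite -ball_normE /= -rmorphB normcJ.
Qed.

Definition ctsD f g : CX := mkcts (cts_add (f := f) (g := g)).
Definition ctsN f : CX := mkcts (cts_opp (f := f)).
Definition ctsM f g : CX := mkcts (cts_mul (f := f) (g := g)).
Definition ctsC (c : R[i]) : CX := cst c.
Definition ctsJ f : CX := mkcts (cts_conj (f := f)).

Let ctsDA : associative ctsD.
Proof. by move=> f g h; apply/continuousEP => x; exact: addrA. Qed.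
Let ctsDC : commutative ctsD.
Proof. by move=> f g; apply/continuousEP => x; exact: addrC. Qed.
Let cts0D : left_id (ctsC 0) ctsD.
Proof. by move=> f; apply/continuousEP => x; exact: add0r. Qed.
Let ctsND : left_inverse (ctsC 0) ctsN ctsD.
Proof. by move=> f; apply/continuousEP => x; exact: addNr. Qed.

HB.instance Definition _ :=
  GRing.isZmodule.Build CX ctsDA ctsDC cts0D ctsND.

Let ctsMA : associative ctsM.
Proof. by move=> f g h; apply/continuousEP => x; exact: mulrA. Qed.
Let cts1M : left_id (ctsC 1) ctsM.
Proof. by move=> f; apply/continuousEP => x; exact: mul1r. Qed.
Let ctsM1 : right_id (ctsC 1) ctsM.
Proof. by move=> f; apply/continuousEP => x; exact: mulr1. Qed.
Let ctsMDl : left_distributive ctsM +%R.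
Proof. by move=> f g h; apply/continuousEP => x; exact: mulrDl. Qed.
Let ctsMDr : right_distributive ctsM +%R.
Proof. by move=> f g h; apply/continuousEP => x; exact: mulrDr. Qed.

HB.instance Definition _ :=
  GRing.Zmodule_isPzRing.Build CX ctsMA cts1M ctsM1 ctsMDl ctsMDr.

Definition ctsZ (c : R[i]) f : CX := ctsM (ctsC c) f.
Let ctsZA (c d : R[i]) f : ctsZ c (ctsZ d f) = ctsZ (c * d) f.
Proof. by apply/continuousEP => x; exact: mulrA. Qed.
Let cts1Z : left_id 1 ctsZ.
Proof. by move=> f; apply/continuousEP => x; exact: mul1r. Qed.
Let ctsZDr : right_distributive ctsZ +%R.
Proof. by move=> c f g; apply/continuousEP => x; exact: mulrDr. Qed.
Let ctsZDl f : {morph ctsZ^~ f : c d / c + d}.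
Proof. by move=> c d; apply/continuousEP => x; exact: mulrDl. Qed.

HB.instance Definition _ :=
  GRing.Zmodule_isLmodule.Build R[i] CX ctsZA cts1Z ctsZDr ctsZDl.

End ContinuousFunctions.

(** * Homeomorphisms and crossed products by Z *)

Record homeo (X : topologicalType) := Homeo {
  hfun :> X -> X;
  hinv : X -> X;
  hfun_continuous : continuous hfun;
  hinv_continuous : continuous hinv;
  hfunK : cancel hfun hinv;
  hinvK : cancel hinv hfun }.

(* Negz n stands for the integer - n.+1. *)
Definition hiter (X : topologicalType) (h : homeo X) (n : int) : X -> X :=
  match n with
  | Posz n => iter n h
  | Negz n => iter n.+1 (hinv h)
  end.

Lemma hiter_continuous (X : topologicalType) (h : homeo X) (n : int) :
  continuous (hiter h n).
Proof.
have it (f : X -> X) k : continuous f -> continuous (iter k f).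
  move=> cf; elim: k => [|k IH] x; first exact: cvg_id.
  by apply: (@continuous_comp _ _ _ (iter k f) f); [exact: IH|exact: cf].
by case: n => n; apply: it; [exact: hfun_continuous|exact: hinv_continuous].
Qed.

Section CrossedProduct.
Context {R : realType} {X : topologicalType}.
Local Notation CX := (continuousType X R[i]).

(* alpha_n(f)(x) = f(h^{-n}(x)) *)
Definition cts_action (h : homeo X) (n : int) (f : CX) : CX :=
  f \o mkcts (@hiter_continuous X h (- n)).

Record covariant_rep (h : homeo X) (A : cstarAlgType R)
    (rho : CX -> A) (U : int -> A) : Prop := CovariantRep {
  rho_linear : linear rho;
  rho_monoid : monoid_morphism rho;
  rho_star : forall f, rho (ctsJ f) = star (rho f);
  (* with U_star, U is a homomorphism from Z to the unitary group of A *)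
  U_0 : U 0 = 1;
  U_D : forall m n, U (m + n) = U m * U n;
  U_star : forall n, star (U n) = U (- n);
  U_covariant : forall n f, U n * rho f * star (U n) = rho (cts_action h n f) }.

(* A is a model of the full crossed product, characterized up to
   *-isomorphism by its universal property. *)
Definition is_crossed_product (h : homeo X) (A : cstarAlgType R) : Prop :=
  exists (iX : CX -> A) (iZ : int -> A),
    covariant_rep h iX iZ /\
    forall (B : cstarAlgType R) (rho : CX -> B) (V : int -> B),
      covariant_rep h rho V ->
      exists! Phi : A -> B,
        [/\ star_hom Phi, forall f, Phi (iX f) = rho f
          & forall n, Phi (iZ n) = V n].

End CrossedProduct.

Section Restriction.
Context {T : topologicalType} (h : homeo T) (X : set T) (hX : h @` X = X).

Let fwd_in (x : X) : h (val x) \in X.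
Proof.
by apply/mem_set; rewrite -[X in X _]hX; exists (val x) => //; exact: set_valP.
Qed.

Let bwd_in (x : X) : hinv h (val x) \in X.
Proof.
apply/mem_set; have := set_valP x; rewrite -[X in X _ -> _]hX => -[y Xy <-].
by rewrite hfunK.
Qed.

Definition restr_fwd (x : X) : X := exist _ (h (val x)) (fwd_in x).
Definition restr_bwd (x : X) : X := exist _ (hinv h (val x)) (bwd_in x).

Let val_continuous : continuous (val : X -> T).
Proof. exact: initial_continuous. Qed.

Let fwd_continuous : continuous restr_fwd.
Proof.
apply: continuous_comp_initial => x.
apply: (@continuous_comp _ _ _ (val : X -> T) h); first exact: val_continuous.
exact: hfun_continuous.
Qed.

Let bwd_continuous : continuous restr_bwd.
Proof.
apply: continuous_comp_initial => x.
apply: (@continuous_comp _ _ _ (val : X -> T) (hinv h)).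
  exact: val_continuous.
exact: hinv_continuous.
Qed.

Let fwdK : cancel restr_fwd restr_bwd.
Proof. by move=> x; apply: val_inj => /=; rewrite hfunK. Qed.
Let bwdK : cancel restr_bwd restr_fwd.
Proof. by move=> x; apply: val_inj => /=; rewrite hinvK. Qed.

Definition homeo_restr : homeo X :=
  Homeo fwd_continuous bwd_continuous fwdK bwdK.

End Restriction.

(** * The unit circle and rotations *)

Section Circle.
Context {R : realType}.
Local Notation C := R[i].

Definition circle : set C := [set z | `|z| = 1].

Definition expi (t : R) : C := (cos t +i* sin t)%C.

Lemma norm_expi t : `|expi t| = 1.
Proof. by rewrite normc_def /= cos2Dsin2 sqrtr1. Qed.

Definition circle_pt (t : R) : circle :=
  exist _ (expi t) (mem_set (norm_expi t)).

Definition rot_angle (p q : int) : R := 2 * p%:~R / q%:~R * pi.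

Let w p q := expi (rot_angle p q).

Let w_neq0 p q : w p q != 0.
Proof. by rewrite -normr_eq0 norm_expi oner_neq0. Qed.

Let mulr_cts (c : C) : continuous (fun z : C => z * c).
Proof. exact: (@mulrr_continuous C). Qed.

Let rotK p q : cancel (fun z => z * w p q) (fun z => z * (w p q)^-1).
Proof. by move=> z; rewrite mulfK. Qed.
Let rotVK p q : cancel (fun z => z * (w p q)^-1) (fun z => z * w p q).
Proof. by move=> z; rewrite mulfVK. Qed.

Definition rotation (p q : int) : homeo C :=
  Homeo (@mulr_cts (expi (rot_angle p q)))
        (@mulr_cts (expi (rot_angle p q))^-1)
        (@rotK p q) (@rotVK p q).

Lemma rotation_circle p q : rotation p q @` circle = circle.
Proof.
apply/seteqP; split => [_ [z z1 <-]|z z1] /=.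
  by rewrite /circle /= normrM norm_expi mulr1.
exists (z * (w p q)^-1); last by rewrite /= mulfVK.
by rewrite /circle /= normrM normfV norm_expi invr1 mulr1.
Qed.

(** * Hardy space and Toeplitz operators *)

(* Elements of L^2(T) are represented by functions, not by classes modulo
   almost everywhere equality.  A closed_subspace below is nevertheless stable
   under that equality, being closed for L2norm, and the zero subspace is the
   set of functions of norm 0. *)
Local Notation mu := (@lebesgue_measure R).
Local Notation angles := (`[0, 2 * pi]%classic : set R).
Local Notation fn := (set_type circle -> C).

(* Integral against normalized arc length dt / 2pi. *)
Definition circle_int (f : fn) : C :=
  let arc_mean (h : R -> R) := (\int[mu]_(t in angles) h t) / (2 * pi) in
  (arc_mean (fun t => complex.Re (f (circle_pt t)))
   +i* arc_mean (fun t => complex.Im (f (circle_pt t))))%C.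

Definition L2_fun : set fn := [set f : fn |
  [/\ measurable_fun angles (fun t : R => complex.Re (f (circle_pt t))),
      measurable_fun angles (fun t : R => complex.Im (f (circle_pt t)))
    & (\int[mu]_(t in angles)
         ((complex.Re `|f (circle_pt t)|) ^+ 2)%:E < +oo)%E]].

Definition inner (f g : fn) : C := circle_int (fun z => f z * conjc (g z)).

Definition L2norm (f : fn) : R := Num.sqrt (complex.Re (inner f f)).

Definition fourier_coef (f : fn) (n : int) : C :=
  circle_int (fun z => f z * val z ^ (- n)).

Definition hardy : set fn :=
  [set f : fn | L2_fun f /\ forall n : int, n < 0 -> fourier_coef f n = 0].

(* Orthogonal projection of L^2(T) onto H^2; its value is a representative,
   determined up to almost everywhere equality. *)
Definition hardy_proj (f : fn) : fn :=
  get [set g : fn | hardy g /\ forall k, hardy k -> inner (f - g) k = 0].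

Definition toeplitz (psi g : fn) : fn := hardy_proj (psi * g).

Record closed_subspace (M : set fn) : Prop := ClosedSubspace {
  csub_hardy : M `<=` hardy;
  csub_0 : M 0;
  csub_lin : forall (c : C) f g, M f -> M g -> M (c *: f + g);
  csub_closed : forall (u : nat -> fn) f, (forall n, M (u n)) ->
    L2_fun f -> L2norm (u n - f) @[n --> \oo] --> (0 : R) -> M f }.

Definition hardy_orthogonal (M : set fn) : set fn :=
  [set g : fn | hardy g /\ forall f, M f -> inner g f = 0].

Definition reducing (S : fn -> fn) (M : set fn) : Prop :=
  (forall g, M g -> M (S g)) /\
  (forall g, hardy_orthogonal M g -> hardy_orthogonal M (S g)).

Definition irreducible_op (S : fn -> fn) : Prop :=
  forall M : set fn, closed_subspace M -> reducing S M ->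
    M = [set f : fn | hardy f /\ L2norm f = 0] \/ M = hardy.

End Circle.

(* Main.v *)
(* The irreducible representations of B = C(T) x Z all have dimension q and are
   classified by a point of a 2-torus: a pair of unitaries (u, v) in M_q with
   u v = w v u, where w is a primitive q-th root of unity, is determined up to
   unitary equivalence by the scalars u^q and v^q.  The spectrum of
   A = C(psi(T)) x Z is instead (T with one whisker) x T, and the equivariant
   homotopy pushing the whiskers towards the circle deforms the identity of A
   into endomorphisms killing a function supported near the whisker tips.

   If g : A -> B were an isomorphism, composing these endomorphisms with a
   torus of representations of B would deform the identity map of the torus,
   near the point (a, b) given by the tip representation of A.  A winding number
   argument shows that the deformed map still takes the value (a, b), so that a
   representation of A killing the function would be equivalent to the tip
   representation, which does not kill it.

   Only the universal property of the crossed products is used: every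
   homotopy or torus of representations is a single *-homomorphism into an
   algebra of bounded continuous families of q x q matrices. *)
From HB Require Import structures.
Require Import Defs.
From mathcomp Require Import all_boot all_order all_algebra fingroup perm.
From mathcomp Require Import complex.
From mathcomp Require Import all_classical all_reals all_analysis.
From mathcomp Require Import ring lra.
Set Implicit Arguments.
Unset Strict Implicit.
Unset Printing Implicit Defensive.
Import Order.TTheory GRing.Theory Num.Theory.
Import numFieldNormedType.Exports.
Local Open Scope classical_set_scope.
Local Open Scope ring_scope.

(** Homotopy invariants such as K-theory cannot separate the two algebras: pushing the whiskers
    outward retracts them equivariantly onto the circle, so the crossed products are homotopy
    equivalent. What differs is local. The torus of representations of [B] has no boundary, whereas
    the tip sits on the boundary of the spectrum of [A].

    Accordingly only a chart of the torus around the tip representation is used, [z] going to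
    [(a * expi (Re z), b * expi (Im z))], and the degree argument becomes the existence of a zero of
    a planar map on a disc.

    The image of the tip representation under the isomorphism need not be written as an orbit
    representation of [B]; its two scalars are read off from eigenvectors, and equality of scalars
    is turned into an inclusion of kernels.

    The universal property says nothing about norms, yet deforming a representation must produce a
    continuous family. This rests on the contractivity of unital *-homomorphisms of [C(X)], which
    makes the deformation continuous uniformly in the other parameter. *)

Lemma continuous_compose (X Y Z : topologicalType) (f : X -> Y) (g : Y -> Z) :
  continuous f -> continuous g -> continuous (fun x => g (f x)).
Proof. by move=> cf cg x; apply: (@continuous_comp _ _ _ f g); [exact: cf|exact: cg]. Qed.

(** * The modulus of a complex number as a real number *)

Section Modulus.
Context {R : realType}.
Local Notation C := R[i].
Implicit Types z w : C.

(** The norm of [R[i]] takes its values in [R[i]]; the estimates below, and square roots, need a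
    real number. *)
Definition cmod z : R := complex.Re `|z|.

Lemma cmodE z : `|z| = (cmod z)%:C%C.
Proof. by rewrite /cmod normc_def. Qed.

Lemma cmod_sqrE z : cmod z ^+ 2 = complex.Re z ^+ 2 + complex.Im z ^+ 2.
Proof. by rewrite /cmod normc_def /= sqr_sqrtr// addr_ge0 ?sqr_ge0. Qed.

Lemma cmod_ge0 z : 0 <= cmod z.
Proof. by rewrite /cmod normc_def sqrtr_ge0. Qed.

Lemma cmod0 : cmod 0 = 0. Proof. by rewrite /cmod normr0. Qed.
Lemma cmod1 : cmod 1 = 1. Proof. by rewrite /cmod normr1. Qed.

Lemma cmod_eq0 z : cmod z = 0 -> z = 0.
Proof. by move=> z0; apply/eqP; rewrite -normr_eq0 cmodE z0. Qed.

Lemma cmodM z w : cmod (z * w) = cmod z * cmod w.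
Proof. by apply: complexI; rewrite -cmodE normrM !cmodE -rmorphM. Qed.

Lemma cmodD z w : cmod (z + w) <= cmod z + cmod w.
Proof. by rewrite -lecR rmorphD /= -!cmodE ler_normD. Qed.

Lemma cmodN z : cmod (- z) = cmod z. Proof. by rewrite /cmod normrN. Qed.

Lemma cmodB z w : cmod (z - w) = cmod (w - z).
Proof. by rewrite -cmodN opprB. Qed.

Lemma cmod_sum (I : finType) (f : I -> C) : cmod (\sum_i f i) <= \sum_i cmod (f i).
Proof.
elim/big_ind2 : _ => [|x a y b xa yb|//]; first by rewrite cmod0.
exact: le_trans (cmodD _ _) (lerD xa yb).
Qed.

Lemma cmod_conj z : cmod (conjc z) = cmod z. Proof. by rewrite /cmod normcJ. Qed.

Lemma cmod_real (x : R) : cmod (x%:C)%C = `|x|.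
Proof. by rewrite /cmod normc_def /= expr0n addr0 sqrtr_sqr. Qed.

Lemma cmod_Re z : `|complex.Re z| <= cmod z.
Proof. by rewrite -lecR -cmodE normc_ge_Re. Qed.

Lemma cmod_Im z : `|complex.Im z| <= cmod z.
Proof.
rewrite -(ger0_norm (cmod_ge0 z)) -ler_sqr ?nnegrE//.
by rewrite !real_normK ?num_real// cmod_sqrE lerDr sqr_ge0.
Qed.

Lemma cmod_le z : cmod z <= `|complex.Re z| + `|complex.Im z|.
Proof.
rewrite -ler_sqr ?nnegrE ?cmod_ge0// ?addr_ge0// cmod_sqrE.
rewrite sqrrD !real_normK ?num_real// lerD2r lerDl mulrn_wge0//.
Qed.

Lemma mulcJ z : z * conjc z = ((cmod z ^+ 2)%:C)%C.
Proof. by rewrite -sqr_normc cmodE -rmorphXn. Qed.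

Lemma cmod_unimodular z : `|z| = 1 -> z * conjc z = 1.
Proof. by rewrite -sqr_normc => ->; rewrite expr1n. Qed.

Lemma cvg_cmodP (T : topologicalType) (F : set_system T) (FF : Filter F)
    (f : T -> C) (l : C) :
  (f @ F --> l) <-> (forall e : R, 0 < e -> \forall t \near F, cmod (l - f t) < e).
Proof.
split=> [/cvgrPdist_lt fl e e0|fl].
  have : 0 < (e%:C)%C :> C by rewrite ltcR.
  by move=> /fl; apply: filterS => t; rewrite cmodE ltcR.
(* A positive complex number has imaginary part 0, so complex and real radii give the same
   neighbourhoods. *)
apply/cvgrPdist_lt => -[e ei]; rewrite ltcE /= => /andP[/eqP -> e0].
by move: (fl e e0); apply: filterS => t; rewrite cmodE ltcR.
Qed.

Lemma near_cmod z (e : R) : 0 < e -> \forall w \near z, cmod (z - w) < e.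
Proof. by move: e; apply/(@cvg_cmodP _ (nbhs z)); exact: cvg_id. Qed.

Lemma continuous_Re : continuous (@complex.Re R : C -> R).
Proof.
move=> z; have FF := nbhs_filter z; apply/cvgrPdist_lt => e e0.
apply: filterS (near_cmod z e0) => w; apply: le_lt_trans.
by rewrite -raddfB; exact: cmod_Re.
Qed.

Lemma continuous_Im : continuous (@complex.Im R : C -> R).
Proof.
move=> z; have FF := nbhs_filter z; apply/cvgrPdist_lt => e e0.
apply: filterS (near_cmod z e0) => w; apply: le_lt_trans.
by rewrite -raddfB; exact: cmod_Im.
Qed.

Lemma cvg_complex (T : topologicalType) (F : set_system T) (FF : Filter F)
    (a b : T -> R) (x y : R) : a @ F --> x -> b @ F --> y ->
  (fun t => (a t +i* b t)%C) @ F --> (x +i* y)%C.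
Proof.
move=> /cvgrPdist_lt ax /cvgrPdist_lt bY; apply/cvg_cmodP => e e0.
have e2 : 0 < e / 2 by rewrite divr_gt0.
near=> t; apply: le_lt_trans (cmod_le _) _ => /=.
rewrite [ltRHS]splitr ltrD//.
  by near: t; exact: ax.
by near: t; exact: bY.
Unshelve. all: by end_near. Qed.

Lemma continuous_cmod : continuous cmod.
Proof.
move=> z; have FF := nbhs_filter z; apply/cvgrPdist_lt => e e0.
apply: filterS (near_cmod z e0) => w; apply: le_lt_trans.
have h (a b : C) : cmod a - cmod b <= cmod (a - b).
  by rewrite lerBlDr (le_trans _ (cmodD _ _))// subrK.
by rewrite ler_norml h andbT lerNl opprB cmodB h.
Qed.

Lemma continuous_conjc : continuous (@conjc R : C -> C).
Proof.
move=> z; have FF := nbhs_filter z; apply/cvg_cmodP => e e0.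
by apply: filterS (near_cmod z e0) => w; rewrite -rmorphB cmod_conj.
Qed.

End Modulus.

(** * Adjoints and Euclidean norms *)

Section Adjoint.
Context {R : realType}.
Local Notation C := R[i].

Definition hadj m n (A : 'M[C]_(m, n)) : 'M[C]_(n, m) := map_mx (@conjc R) A^T.

Lemma hadjE m n (A : 'M[C]_(m, n)) i j : hadj A i j = conjc (A j i).
Proof. by rewrite !mxE. Qed.

Lemma hadjK m n : cancel (@hadj m n) (@hadj n m).
Proof. by move=> A; apply/matrixP => i j; rewrite !hadjE conjcK. Qed.

Lemma hadjD m n (A B : 'M[C]_(m, n)) : hadj (A + B) = hadj A + hadj B.
Proof. by rewrite /hadj linearD map_mxD. Qed.

Lemma hadjM m n p (A : 'M[C]_(m, n)) (B : 'M[C]_(n, p)) :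
  hadj (A *m B) = hadj B *m hadj A.
Proof. by rewrite /hadj trmx_mul map_mxM. Qed.

Lemma hadjZ m n c (A : 'M[C]_(m, n)) : hadj (c *: A) = conjc c *: hadj A.
Proof. by rewrite /hadj linearZ map_mxZ. Qed.

Definition vdot m (x y : 'cV[C]_m) : C := (hadj x *m y) 0 0.

Lemma vdotE m (x y : 'cV[C]_m) : vdot x y = \sum_i conjc (x i 0) * y i 0.
Proof. by rewrite /vdot mxE; apply: eq_bigr => i _; rewrite hadjE. Qed.

Lemma vdotMr m n (A : 'M[C]_(m, n)) x y : vdot x (A *m y) = vdot (hadj A *m x) y.
Proof. by rewrite /vdot hadjM hadjK mulmxA. Qed.

Lemma vdotZl m c (x y : 'cV[C]_m) : vdot (c *: x) y = conjc c * vdot x y.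
Proof. by rewrite /vdot hadjZ -scalemxAl mxE. Qed.

Lemma vdotZr m c (x y : 'cV[C]_m) : vdot x (c *: y) = c * vdot x y.
Proof. by rewrite /vdot -scalemxAr mxE. Qed.

Definition vnorm m (x : 'cV[C]_m) : R := Num.sqrt (\sum_i cmod (x i 0) ^+ 2).

Lemma vnorm_ge0 m (x : 'cV[C]_m) : 0 <= vnorm x.
Proof. exact: sqrtr_ge0. Qed.

Lemma vnorm_sqrE m (x : 'cV[C]_m) : vnorm x ^+ 2 = \sum_i cmod (x i 0) ^+ 2.
Proof. by rewrite sqr_sqrtr// sumr_ge0// => i _; exact: sqr_ge0. Qed.

Lemma vdot_sqr m (x : 'cV[C]_m) : vdot x x = (vnorm x ^+ 2)%:C%C.
Proof.
rewrite vdotE vnorm_sqrE rmorph_sum; apply: eq_bigr => i _.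
by rewrite mulrC mulcJ.
Qed.

Lemma cmod_le_vnorm m (x : 'cV[C]_m) i : cmod (x i 0) <= vnorm x.
Proof.
rewrite -ler_sqr ?nnegrE ?cmod_ge0 ?vnorm_ge0// vnorm_sqrE (bigD1 i)//= lerDl.
by rewrite sumr_ge0// => j _; exact: sqr_ge0.
Qed.

Lemma vnorm_le_sum m (x : 'cV[C]_m) : vnorm x <= \sum_i cmod (x i 0).
Proof.
have s0 : 0 <= \sum_i cmod (x i 0) by rewrite sumr_ge0// => i _; exact: cmod_ge0.
rewrite -ler_sqr ?nnegrE ?vnorm_ge0// vnorm_sqrE expr2 mulr_suml.
apply: ler_sum => i _; rewrite expr2 ler_wpM2l ?cmod_ge0//.
by rewrite (bigD1 i)//= lerDl sumr_ge0// => j _; exact: cmod_ge0.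
Qed.

Lemma vnorm_eq0 m (x : 'cV[C]_m) : vnorm x = 0 -> x = 0.
Proof.
move=> x0; apply/matrixP => i j; rewrite ord1 mxE; apply: cmod_eq0.
by apply/le_anti; rewrite cmod_ge0 andbT -x0 cmod_le_vnorm.
Qed.

Lemma vnorm0 m : vnorm (0 : 'cV[C]_m) = 0.
Proof.
rewrite /vnorm big1 ?sqrtr0// => i _.
by rewrite mxE cmod0 expr0n.
Qed.

Lemma vnormZ m c (x : 'cV[C]_m) : vnorm (c *: x) = cmod c * vnorm x.
Proof.
apply: (@pexpIrn _ 2); rewrite ?nnegrE ?mulr_ge0 ?vnorm_ge0 ?cmod_ge0//.
rewrite exprMn !vnorm_sqrE mulr_sumr; apply: eq_bigr => i _.
by rewrite mxE cmodM exprMn.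
Qed.

Lemma vdot_le m (x y : 'cV[C]_m) : cmod (vdot x y) <= vnorm x * vnorm y.
Proof.
have [/vnorm_eq0 ->|x0] := eqVneq (vnorm x) 0.
  by rewrite /vdot vnorm0 mul0r /hadj trmx0 map_mx0 mul0mx mxE cmod0.
have [/vnorm_eq0 ->|y0] := eqVneq (vnorm y) 0.
  by rewrite /vdot vnorm0 mulr0 mulmx0 mxE cmod0.
have xy0 : 0 < vnorm x * vnorm y.
  by rewrite mulr_gt0// lt_neqAle eq_sym vnorm_ge0 ?x0 ?y0.
(* After multiplication by [2 |x| |y|] the inequality holds term by term: it is the expansion of a
   square [(|x_i| |y| - |y_i| |x|)^2 >= 0]. *)
have : (\sum_i cmod (x i 0) * cmod (y i 0)) * (2 * (vnorm x * vnorm y)) <=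
       (vnorm x * vnorm y) * (2 * (vnorm x * vnorm y)).
  have -> : (vnorm x * vnorm y) * (2 * (vnorm x * vnorm y)) =
      \sum_i (cmod (x i 0) ^+ 2 * vnorm y ^+ 2 + cmod (y i 0) ^+ 2 * vnorm x ^+ 2).
    by rewrite big_split/= -!mulr_suml -!vnorm_sqrE; ring.
  rewrite mulr_suml; apply: ler_sum => i _; rewrite -subr_ge0.
  rewrite (_ : _ - _ = (cmod (x i 0) * vnorm y - cmod (y i 0) * vnorm x) ^+ 2).
    exact: sqr_ge0.
  by ring.
rewrite ler_pM2r; last exact: mulr_gt0.
apply: le_trans.
rewrite vdotE; apply: le_trans (cmod_sum _) _.
by apply: ler_sum => i _; rewrite cmodM cmod_conj.
Qed.

Lemma vnormD m (x y : 'cV[C]_m) : vnorm (x + y) <= vnorm x + vnorm y.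
Proof.
rewrite -ler_sqr ?nnegrE ?addr_ge0 ?vnorm_ge0//.
rewrite -lecR -vdot_sqr.
have -> : vdot (x + y) (x + y) = vdot x x + vdot y y + (vdot x y + vdot y x).
  by rewrite /vdot hadjD mulmxDl !mulmxDr !mxE; ring.
have -> : vdot y x = conjc (vdot x y).
  by rewrite /vdot -hadjE hadjM hadjK.
rewrite addcJ !vdot_sqr -!rmorphD.
rewrite (_ : 2%:R = (2%:R : R)%:C%C); last by rewrite rmorph_nat.
rewrite -rmorphM -rmorphD /= lecR sqrrD.
rewrite -[leRHS]addrA [_ *+ 2 + _]addrC addrA lerD2l mulr_natl lerMn2r/=.
by rewrite (le_trans (ler_norm _))// (le_trans (cmod_Re _))// vdot_le.
Qed.

(** An operator-norm bound kept as a predicate; the C*-norm of a family will be the infimum of the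
    bounds common to its values. *)
Definition mbound m n (A : 'M[C]_(m, n)) (c : R) : Prop :=
  forall x, vnorm (A *m x) <= c * vnorm x.

Lemma mbound_entry m n (A : 'M[C]_(m, n)) c i j : mbound A c -> cmod (A i j) <= c.
Proof.
move=> /(_ (delta_mx j 0)).
have -> : vnorm (delta_mx j 0 : 'cV[C]_n) = 1.
  apply: (@pexpIrn _ 2); rewrite ?nnegrE ?vnorm_ge0// vnorm_sqrE expr1n.
  rewrite (bigD1 j)//= mxE !eqxx cmod1 expr1n big1 ?addr0// => k kj.
  by rewrite mxE (negbTE kj) /= cmod0 expr0n.
rewrite mulr1; apply: le_trans; rewrite -colE.
by have := cmod_le_vnorm (col j A) i; rewrite mxE.
Qed.

Lemma mbound_of_entries m n (A : 'M[C]_(m, n)) c :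
  (forall i j, cmod (A i j) <= c) -> mbound A (c *+ n *+ m).
Proof.
move=> Ac x; apply: le_trans (vnorm_le_sum _) _.
have -> : c *+ n *+ m * vnorm x = \sum_(i < m) \sum_(j < n) c * vnorm x.
  by rewrite !sumr_const !card_ord !mulrnAl.
apply: ler_sum => i _; rewrite mxE.
apply: le_trans (cmod_sum _) _; apply: ler_sum => j _.
by rewrite cmodM ler_pM ?cmod_ge0 ?cmod_le_vnorm.
Qed.

End Adjoint.

(** * The C*-algebra of bounded continuous families of matrices *)

Section ComplexLimits.
Context {R : realType}.
Local Notation C := R[i].
Implicit Types (z : nat -> C) (l : C).

Lemma cauchy_cvg_seq (a : nat -> R) :
  (forall e, 0 < e -> exists N : nat, forall m n,
    (N <= m)%N -> (N <= n)%N -> `|a m - a n| < e) -> cvgn a.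
Proof.
move=> aC; apply/cauchy_cvgP/cauchy_exP => e /aC[N aN].
exists (a N); exists N => // m Nm.
by rewrite /ball /=; exact: aN.
Qed.

Lemma cauchy_cmod_cvg z :
  (forall e, 0 < e -> exists N : nat, forall m n,
    (N <= m)%N -> (N <= n)%N -> cmod (z m - z n) < e) ->
  exists l, z @ \oo --> l.
Proof.
move=> zC.
have /cvg_ex[x zx] : cvgn (fun n => complex.Re (z n)).
  apply: cauchy_cvg_seq => e /zC[N zN]; exists N => m n Nm Nn.
  by rewrite -raddfB; apply: le_lt_trans (cmod_Re _) _; exact: zN.
have /cvg_ex[y zy] : cvgn (fun n => complex.Im (z n)).
  apply: cauchy_cvg_seq => e /zC[N zN]; exists N => m n Nm Nn.
  by rewrite -raddfB; apply: le_lt_trans (cmod_Im _) _; exact: zN.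
exists (x +i* y)%C; rewrite (_ : z = fun n => (complex.Re (z n) +i*
  complex.Im (z n))%C); first exact: cvg_complex.
by apply/funext => n; case: (z n).
Qed.

Lemma cmod_lim_le z l w N e : z @ \oo --> l ->
  (forall n, (N <= n)%N -> cmod (w - z n) <= e) -> cmod (w - l) <= e.
Proof.
move=> zl wz; rewrite leNgt; apply/negP => ew.
have /cvg_cmodP/(_ (cmod (w - l) - e)) := zl.
rewrite subr_gt0 => /(_ ew)[m _ /(_ (maxn m N))] /=.
rewrite leq_maxl => /(_ isT); rewrite ltNge => /negP; apply.
set M := maxn m N; have -> : w - l = (w - z M) + (z M - l) by ring.
rewrite lerBlDl cmodB (le_trans (cmodD _ _))// cmodB lerD// ?wz ?leq_maxr//.
Qed.

End ComplexLimits.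

Section MatrixFamilies.
Context {R : realType} (K : ptopologicalType) (n : nat).
Local Notation C := R[i].
Local Notation M := 'M[C]_n.+1.

(** Boundedness is demanded separately because the parameter spaces used later, such as the real
    line and its product with the plane, are not compact. *)
Definition matfam_ok (f : K -> M) : Prop :=
  (forall i j, continuous (fun k => f k i j)) /\
  exists c, forall k, mbound (f k) c.

Definition matfam := {f : K -> M | `[< matfam_ok f >]}.

HB.instance Definition _ := gen_eqMixin matfam.
HB.instance Definition _ := gen_choiceMixin matfam.

Definition mf_val (F : matfam) : K -> M := sval F.
Coercion mf_val : matfam >-> Funclass.

Lemma matfamP (F G : matfam) : (forall k, F k = G k) -> F = G.
Proof. by move=> FG; apply: val_inj; apply/funext. Qed.

Lemma matfam_continuous (F : matfam) i j : continuous (fun k => F k i j).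
Proof. by case: F => f fok; have /asboolP[] := fok. Qed.

Lemma matfam_bounded (F : matfam) : exists c, forall k, mbound (F k) c.
Proof. by case: F => f fok; have /asboolP[] := fok. Qed.

Definition Matfam f (fok : matfam_ok f) : matfam := exist _ f (asboolT fok).

Let add_ok (F G : matfam) : matfam_ok (fun k => F k + G k).
Proof.
split=> [i j k|].
  rewrite (_ : (fun _ => _) = (fun k => F k i j + G k i j)).
    by apply: cvgD; exact: matfam_continuous.
  by apply/funext => l; rewrite mxE.
have [c Fc] := matfam_bounded F; have [d Gd] := matfam_bounded G.
exists (c + d) => k x; rewrite mulmxDl mulrDl.
by rewrite (le_trans (vnormD _ _))// lerD ?Fc ?Gd.
Qed.

Let mul_ok (F G : matfam) : matfam_ok (fun k => F k *m G k).
Proof.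
split=> [i j k|].
  rewrite (_ : (fun _ => _) = (fun k => \sum_l F k i l * G k l j)).
    apply: cvg_big => [|l _]; first (by move=> x; apply: cvgD; [exact: cvg_fst|exact: cvg_snd]).
    by apply: cvgM; exact: matfam_continuous.
  by apply/funext => l; rewrite mxE.
have [c Fc] := matfam_bounded F; have [d Gd] := matfam_bounded G.
exists (`|c| * d) => k x; rewrite -mulmxA -mulrA.
rewrite (le_trans (Fc _ _))// (le_trans (ler_wpM2r (vnorm_ge0 _) (ler_norm _)))//.
by rewrite ler_wpM2l ?Gd.
Qed.

Let scale_ok (a : C) (F : matfam) : matfam_ok (fun k => a *: F k).
Proof.
split=> [i j k|].
  rewrite (_ : (fun _ => _) = (fun k => a * F k i j)).
    by apply: cvgM; [exact: cvg_cst|exact: matfam_continuous].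
  by apply/funext => l; rewrite mxE.
have [c Fc] := matfam_bounded F.
exists (cmod a * c) => k x; rewrite -scalemxAl vnormZ -mulrA.
by rewrite ler_wpM2l ?cmod_ge0 ?Fc.
Qed.

Let cst_ok (A : M) : matfam_ok (fun=> A).
Proof.
split=> [i j k|]; first exact: cvg_cst.
exists ((\sum_i \sum_j cmod (A i j)) *+ n.+1 *+ n.+1) => k.
apply: mbound_of_entries => i j.
rewrite (bigD1 i)//= (bigD1 j)//= -addrA lerDl addr_ge0//.
  by rewrite sumr_ge0// => l _; exact: cmod_ge0.
by rewrite sumr_ge0// => l _; rewrite sumr_ge0// => m _; exact: cmod_ge0.
Qed.

Let adj_ok (F : matfam) : matfam_ok (fun k => hadj (F k)).
Proof.
have [c Fc] := matfam_bounded F; split=> [i j k|].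
  rewrite (_ : (fun _ => _) = (fun k => conjc (F k j i))).
    apply: (@continuous_comp _ _ _ (fun k => F k j i) (@conjc R)).
      exact: matfam_continuous.
    exact: continuous_conjc.
  by apply/funext => l; rewrite hadjE.
exists (c *+ n.+1 *+ n.+1) => k; apply: mbound_of_entries => i j.
by rewrite hadjE cmod_conj; exact: mbound_entry.
Qed.

Definition mfD F G := Matfam (add_ok F G).
Definition mfM F G := Matfam (mul_ok F G).
Definition mfZ a F := Matfam (scale_ok a F).
Definition mfC A := Matfam (cst_ok A).
Definition mfJ F := Matfam (adj_ok F).
Definition mfN F := mfZ (-1) F.

Let mfDA : associative mfD.
Proof. by move=> F G H; apply/matfamP => k; exact: addrA. Qed.
Let mfDC : commutative mfD.
Proof. by move=> F G; apply/matfamP => k; exact: addrC. Qed.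
Let mf0D : left_id (mfC 0) mfD.
Proof. by move=> F; apply/matfamP => k; exact: add0r. Qed.
Let mfND : left_inverse (mfC 0) mfN mfD.
Proof. by move=> F; apply/matfamP => k /=; rewrite /mf_val/= scaleN1r addNr. Qed.
HB.instance Definition _ := GRing.isZmodule.Build matfam mfDA mfDC mf0D mfND.

Let mfMA : associative mfM.
Proof. by move=> F G H; apply/matfamP => k; exact: mulmxA. Qed.
Let mf1M : left_id (mfC 1%:M) mfM.
Proof. by move=> F; apply/matfamP => k; exact: mul1mx. Qed.
Let mfM1 : right_id (mfC 1%:M) mfM.
Proof. by move=> F; apply/matfamP => k; exact: mulmx1. Qed.
Let mfMDl : left_distributive mfM +%R.
Proof. by move=> F G H; apply/matfamP => k; exact: mulmxDl. Qed.
Let mfMDr : right_distributive mfM +%R.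
Proof. by move=> F G H; apply/matfamP => k; exact: mulmxDr. Qed.
HB.instance Definition _ :=
  GRing.Zmodule_isPzRing.Build matfam mfMA mf1M mfM1 mfMDl mfMDr.

Let mf1_neq0 : (1 : matfam) != 0.
Proof.
apply/eqP => /(congr1 (fun F : matfam => F point 0 0)).
by rewrite !mxE eqxx => /eqP; rewrite oner_eq0.
Qed.
HB.instance Definition _ := GRing.PzSemiRing_isNonZero.Build matfam mf1_neq0.

Let mfZA a b F : mfZ a (mfZ b F) = mfZ (a * b) F.
Proof. by apply/matfamP => k; exact: scalerA. Qed.
Let mf1Z : left_id 1 mfZ.
Proof. by move=> F; apply/matfamP => k; exact: scale1r. Qed.
Let mfZDr : right_distributive mfZ +%R.
Proof. by move=> a F G; apply/matfamP => k; exact: scalerDr. Qed.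
Let mfZDl F : {morph mfZ^~ F : a b / a + b}.
Proof. by move=> a b; apply/matfamP => k; exact: scalerDl. Qed.
HB.instance Definition _ :=
  GRing.Zmodule_isLmodule.Build R[i] matfam mfZA mf1Z mfZDr mfZDl.

Let mfZAl (a : C) (F G : matfam) : a *: (F * G) = (a *: F) * G.
Proof. by apply/matfamP => k; exact: scalemxAl. Qed.
HB.instance Definition _ := GRing.LSemiModule_isLSemiAlgebra.Build R[i] matfam mfZAl.
Let mfZAr (a : C) (F G : matfam) : a *: (F * G) = F * (a *: G).
Proof. by apply/matfamP => k; exact: scalemxAr. Qed.
HB.instance Definition _ := GRing.LSemiAlgebra_isSemiAlgebra.Build R[i] matfam mfZAr.

(** This is the supremum over [k] of the operator norms of [F k], obtained without introducing the
    operator norm itself. *)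
Definition mfnorm : matfam -> R :=
  locked (fun F : matfam => inf [set c | 0 <= c /\ forall k, mbound (F k) c]).

Implicit Types F G : matfam.

Lemma matfamDE F G k : (F + G : matfam) k = F k + G k. Proof. by []. Qed.
Lemma matfamME F G k : (F * G : matfam) k = F k *m G k. Proof. by []. Qed.
Lemma matfamZE c F k : (c *: F : matfam) k = c *: F k. Proof. by []. Qed.
Lemma matfam1E k : (1 : matfam) k = 1%:M. Proof. by []. Qed.
Lemma matfamBE F G k : (F - G : matfam) k = F k - G k.
Proof. by rewrite matfamDE -scaleN1r matfamZE scaleN1r. Qed.
Lemma mfJE F k : mfJ F k = hadj (F k). Proof. by []. Qed.

Let has_inf_mfnorm F : has_inf [set c | 0 <= c /\ forall k, mbound (F k) c].
Proof.
split; last by exists 0 => c [].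
have [c Fc] := matfam_bounded F.
exists `|c|; split=> // k x; rewrite (le_trans (Fc k x))//.
by rewrite ler_wpM2r ?vnorm_ge0 ?ler_norm.
Qed.

Let mfnormE F : mfnorm F = inf [set c | 0 <= c /\ forall k, mbound (F k) c].
Proof. by rewrite /mfnorm -lock. Qed.

Lemma mfnorm_le F c : 0 <= c -> (forall k, mbound (F k) c) -> mfnorm F <= c.
Proof. by move=> c0 Fc; rewrite mfnormE; apply: ge_inf; [exists 0 => ? []|split]. Qed.

Lemma mfnorm_ge0 F : 0 <= mfnorm F.
Proof. by rewrite mfnormE; apply: lb_le_inf => [|c []//]; case: (has_inf_mfnorm F). Qed.

(** The infimum is attained: for fixed nonzero [x] the ratio [|F k x| / |x|] is a lower bound of the
    set of common bounds. *)
Lemma mbound_mfnorm F k : mbound (F k) (mfnorm F).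
Proof.
move=> x; have [/vnorm_eq0 ->|x0] := eqVneq (vnorm x) 0.
  by rewrite mulmx0 vnorm0 mulr0.
have {}x0 : 0 < vnorm x by rewrite lt_neqAle eq_sym x0 vnorm_ge0.
rewrite -ler_pdivrMr// mfnormE; apply: lb_le_inf; first by case: (has_inf_mfnorm F).
by move=> c [_ Fc]; rewrite ler_pdivrMr//; exact: Fc.
Qed.

Lemma cmod_le_mfnorm F k i j : cmod (F k i j) <= mfnorm F.
Proof. exact: mbound_entry (mbound_mfnorm F k). Qed.

Let mfJD F G : mfJ (F + G) = mfJ F + mfJ G.
Proof. by apply/matfamP => k; rewrite matfamDE !mfJE matfamDE hadjD. Qed.
Let mfJZ c F : mfJ (c *: F) = conjc c *: mfJ F.
Proof. by apply/matfamP => k; rewrite matfamZE !mfJE matfamZE hadjZ. Qed.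
Let mfJM F G : mfJ (F * G) = mfJ G * mfJ F.
Proof. by apply/matfamP => k; rewrite matfamME !mfJE matfamME hadjM. Qed.
Let mfJK F : mfJ (mfJ F) = F.
Proof. by apply/matfamP => k; rewrite !mfJE hadjK. Qed.

Let mfnorm_eq0 F : mfnorm F = 0 -> F = 0.
Proof.
move=> F0; apply/matfamP => k; apply/matrixP => i j; rewrite mxE.
by apply: cmod_eq0; apply/le_anti; rewrite cmod_ge0 -F0 cmod_le_mfnorm.
Qed.

Let mfnormZ_le c F : mfnorm (c *: F) <= cmod c * mfnorm F.
Proof.
apply: mfnorm_le => [|k x]; first by rewrite mulr_ge0 ?cmod_ge0 ?mfnorm_ge0.
rewrite -scalemxAl vnormZ -mulrA ler_wpM2l ?cmod_ge0//.
exact: mbound_mfnorm.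
Qed.

Let mfnormZ c F : mfnorm (c *: F) = cmod c * mfnorm F.
Proof.
apply/le_anti; rewrite mfnormZ_le/=.
have [->|c0] := eqVneq c 0; first by rewrite cmod0 mul0r mfnorm_ge0.
have cmod0 : 0 < cmod c.
  by rewrite lt_neqAle cmod_ge0 andbT eq_sym; apply: contra_neq c0; exact: cmod_eq0.
rewrite -ler_pdivlMl//.
have -> : (cmod c)^-1 = cmod (c^-1).
  apply: (mulfI (lt0r_neq0 cmod0)).
  by rewrite divff ?gt_eqF// -cmodM divff// cmod1.
(* The reverse inequality is [mfnormZ_le] for the scalar [c^-1] and the family [c *: F]. *)
have {1}<- : c^-1 *: (c *: F) = F 
  by apply: etrans (mfZA c^-1 c F) _; rewrite mulVf//; exact: mf1Z.
exact: mfnormZ_le.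
Qed.

Let mfnormD F G : mfnorm (F + G) <= mfnorm F + mfnorm G.
Proof.
apply: mfnorm_le => [|k x]; first by rewrite addr_ge0 ?mfnorm_ge0.
by rewrite mulmxDl mulrDl (le_trans (vnormD _ _))// lerD ?mbound_mfnorm.
Qed.

Let mfnormM F G : mfnorm (F * G) <= mfnorm F * mfnorm G.
Proof.
apply: mfnorm_le => [|k x]; first by rewrite mulr_ge0 ?mfnorm_ge0.
rewrite -mulmxA -mulrA (le_trans (mbound_mfnorm _ _ _))//.
by rewrite ler_wpM2l ?mfnorm_ge0 ?mbound_mfnorm.
Qed.

(** The half of the C*-identity that needs the inner product: [|F x|^2] is the inner product of [x]
    with [F^* F x], bounded by Cauchy-Schwarz. *)
Let mfnorm_sqr_le F : mfnorm F ^+ 2 <= mfnorm (mfJ F * F).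
Proof.
suff : mfnorm F <= Num.sqrt (mfnorm (mfJ F * F)).
  by rewrite -ler_sqr ?nnegrE ?sqrtr_ge0 ?mfnorm_ge0// sqr_sqrtr// mfnorm_ge0.
apply: mfnorm_le => [|k x]; first exact: sqrtr_ge0.
rewrite -ler_sqr ?nnegrE ?mulr_ge0 ?sqrtr_ge0 ?vnorm_ge0//.
have -> : vnorm (F k *m x) ^+ 2 = cmod (vdot x (hadj (F k) *m F k *m x)).
  by rewrite -mulmxA vdotMr hadjK vdot_sqr cmod_real ger0_norm// sqr_ge0.
rewrite exprMn [_ ^+ 2 in leRHS]sqr_sqrtr ?mfnorm_ge0//.
rewrite (le_trans (vdot_le _ _))// mulrC expr2 mulrA.
by rewrite ler_wpM2r ?vnorm_ge0// (mbound_mfnorm (mfJ F * F)).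
Qed.

(** Cancel one factor in [|F|^2 <= |F^* F| <= |F^*| |F|]. *)
Let mfnormJ_le F : mfnorm F <= mfnorm (mfJ F).
Proof.
have := le_trans (mfnorm_sqr_le F) (mfnormM (mfJ F) F).
have [-> _|F0] := eqVneq (mfnorm F) 0; first exact: mfnorm_ge0.
by rewrite expr2 ler_pM2r// lt_neqAle eq_sym F0 mfnorm_ge0.
Qed.

Let mfnorm_star F : mfnorm (mfJ F * F) = mfnorm F ^+ 2.
Proof.
have h : mfnorm (mfJ F * F) <= mfnorm F ^+ 2.
  apply: (le_trans (mfnormM (mfJ F) F)); rewrite expr2 ler_wpM2r ?mfnorm_ge0//.
  by have := mfnormJ_le (mfJ F); rewrite mfJK.
by apply/eqP; rewrite eq_le h; exact: mfnorm_sqr_le F.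
Qed.

Let mfnorm_complete (u : nat -> matfam) :
  (forall e : R, 0 < e -> exists N : nat, forall m n : nat,
    (N <= m)%N -> (N <= n)%N -> mfnorm (u m - u n) < e) ->
  exists l, mfnorm (u n - l) @[n --> \oo] --> (0 : R).
Proof.
move=> uC.
have uE m p k i j : u m k i j - u p k i j = (u m - u p : matfam) k i j.
  by rewrite matfamBE !mxE.
have /choice[L] : forall kij : K * ('I_n.+1 * 'I_n.+1), exists l : C,
    u m kij.1 kij.2.1 kij.2.2 @[m --> \oo] --> l.
  move=> [k [i j]] /=; apply: cauchy_cmod_cvg => e /uC[N uN].
  exists N => m p Nm Np; rewrite uE.
  exact: le_lt_trans (cmod_le_mfnorm _ _ _ _) (uN _ _ Nm Np).
move=> uL; pose f k : M := \matrix_(i, j) L (k, (i, j)).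
have uf e : 0 < e -> exists N, forall m, (N <= m)%N ->
    forall k i j, cmod (u m k i j - f k i j) <= e.
  move=> /uC[N uN]; exists N => m Nm k i j; rewrite mxE.
  apply: (cmod_lim_le (uL (k, (i, j))) (N := N)) => p Np /=.
  rewrite uE; exact: le_trans (cmod_le_mfnorm _ _ _ _) (ltW (uN _ _ Nm Np)).
have fok : matfam_ok f.
  split=> [i j k|].
    have FF := nbhs_filter k; apply/cvg_cmodP => e e0.
    have e4 : 0 < e / 4 by rewrite divr_gt0.
    have [N /(_ N (leqnn N)) uN] := uf _ e4.
    have /cvg_cmodP/(_ _ e4) := @matfam_continuous (u N) i j k.
    apply: filterS => t ut.
    rewrite (_ : f k i j - f t i j = - (u N k i j - f k i j) +
      ((u N k i j - u N t i j) + (u N t i j - f t i j))); last by ring.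
    apply: le_lt_trans (cmodD _ _) _; rewrite cmodN.
    have := uN k i j; have := uN t i j; have := cmodD (u N k i j - u N t i j)
      (u N t i j - f t i j).
    by move: ut; set a := cmod _; set b := cmod _; set c := cmod _; set d := cmod _; lra.
  have [N /(_ N (leqnn N)) uN] := uf _ ltr01.
  have [c uc] := matfam_bounded (u N).
  exists ((1 + c) *+ n.+1 *+ n.+1) => k; apply: mbound_of_entries => i j.
  rewrite (_ : f k i j = - (u N k i j - f k i j) + u N k i j); last by ring.
  by rewrite (le_trans (cmodD _ _))// cmodN lerD// (mbound_entry _ _ (uc k)).
exists (Matfam fok); apply/cvgrPdist_le => e e0.
(* Passing from entries to the operator norm in [mbound_of_entries] costs a factor [n.+1 ^ 2]. *)
have e1 : 0 < e / (n.+1%:R * n.+1%:R) by rewrite divr_gt0// mulr_gt0.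
have [N uN] := uf _ e1; exists N => // m Nm /=.
rewrite sub0r normrN ger0_norm ?mfnorm_ge0//.
apply: mfnorm_le => [|k]; first exact: ltW.
have -> : e = e / (n.+1%:R * n.+1%:R) *+ n.+1 *+ n.+1.
  by rewrite -mulrnA -[RHS]mulr_natr natrM divfK// mulf_neq0// pnatr_eq0.
apply: mbound_of_entries => i j.
have -> : (u m - Matfam fok : matfam) k i j = u m k i j - f k i j.
  by rewrite matfamBE !mxE.
exact: uN.
Qed.

HB.instance Definition _ := isCstar.Build R matfam mfJD mfJZ mfJM mfJK
  mfnorm_eq0 mfnormZ mfnormD mfnormM mfnorm_star mfnorm_complete.

End MatrixFamilies.
Arguments matfam : clear implicits.

(** * The exponential parametrization of the circle *)

Section Expi.
Context {R : realType}.
Local Notation C := R[i].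
Implicit Types (s t : R) (z w : C).

Lemma expiD s t : expi (s + t) = expi s * expi t.
Proof. by rewrite /expi cosD sinD; apply/eqP; rewrite eq_complex /= eqxx addrC eqxx. Qed.

Lemma expi0 : expi 0 = 1 :> C.
Proof. by rewrite /expi cos0 sin0. Qed.

Lemma expiN t : expi (- t) = conjc (expi t).
Proof. by rewrite /expi cosN sinN. Qed.

Lemma expiNK t : expi (- t) * expi t = 1.
Proof. by rewrite -expiD addNr expi0. Qed.

Lemma expi_neq0 t : expi t != 0.
Proof. by rewrite -normr_eq0 norm_expi oner_neq0. Qed.

Lemma expiMn t n : expi (t *+ n) = expi t ^+ n.
Proof. by elim: n => [|n IH]; rewrite ?mulr0n ?expi0// mulrS expiD IH exprS. Qed.

Lemma expi_pi : expi pi = -1 :> C.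
Proof. by rewrite /expi cospi sinpi; apply/eqP; rewrite eq_complex /= oppr0 !eqxx. Qed.

Lemma expi_2pi : expi (2 * pi) = 1 :> C.
Proof. by rewrite mulr_natl expiMn expi_pi sqrrN expr1n. Qed.

Lemma expiD2pi t : expi (t + 2 * pi) = expi t.
Proof. by rewrite expiD expi_2pi mulr1. Qed.

Lemma cmod_expi t : cmod (expi t) = 1.
Proof. by rewrite /cmod norm_expi. Qed.

Lemma continuous_expi : continuous (@expi R).
Proof.
by move=> t; apply: cvg_complex; [exact: continuous_cos|exact: continuous_sin].
Qed.

Lemma expi_surj z : `|z| = 1 -> exists2 t, 0 <= t <= 2 * pi & expi t = z.
Proof.
case: z => x y xy1.
have : cmod (x +i* y)%C = 1 by rewrite /cmod xy1.
move=> /(congr1 (fun u => u ^+ 2)); rewrite cmod_sqrE expr1n /= => xy.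
have x1 : -1 <= x <= 1.
  rewrite -ler_norml -(@ler_pXn2r _ 2) ?nnegrE// expr1n real_normK ?num_real//.
  by rewrite -xy lerDl sqr_ge0.
have y2 : y ^+ 2 = 1 - x ^+ 2 by rewrite -xy addrAC subrr add0r.
have cosx : cos (acos x) = x by rewrite acosK// in_itv.
have sinx : sin (acos x) = `|y| by rewrite sin_acos// -y2 sqrtr_sqr.
have ax0 := acos_ge0 x1; have axpi := acos_lepi x1; have pi0 := pi_ge0 R.
have [y0|y0] := leP 0 y.
  exists (acos x); first by apply/andP; split=> //; lra.
  by rewrite /expi cosx sinx ger0_norm.
exists (2 * pi - acos x); first by apply/andP; split; lra.
rewrite addrC expiD2pi expiN /expi cosx sinx /= ltr0_norm// opprK.
by [].
Qed.

Lemma compact_circle : compact (@circle R).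
Proof.
have -> : @circle R = expi @` `[0, 2 * pi].
  apply/seteqP; split=> [z /expi_surj[t t2 <-]|_ [t _ <-]]; last exact: norm_expi.
  by exists t => //=; rewrite in_itv.
apply: continuous_compact; last exact: segment_compact.
by apply: continuous_subspaceT; exact: continuous_expi.
Qed.

Lemma compact_disc : compact [set z : C | cmod z <= 1].
Proof.
have -> : [set z : C | cmod z <= 1] =
    (fun rw : R * C => rw.1%:C%C * rw.2) @` (`[0, 1] `*` @circle R).
  apply/seteqP; split=> [z z1|_ [[r w] /= [r01 w1] <-]] /=.
    have [->|z0] := eqVneq z 0.
      exists (0, 1); last by rewrite mul0r.
      by split=> /=; [rewrite in_itv/= lexx ler01|exact: normr1].
    have nz0 : cmod z != 0 by apply: contra_neq z0; exact: cmod_eq0.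
    have nz0' : (cmod z)%:C%C != 0 :> C by rewrite eq_complex /= negb_and nz0.
    exists (cmod z, z / (cmod z)%:C%C); last by rewrite mulrC divfK.
    split=> /=; first by rewrite in_itv/= cmod_ge0.
    by rewrite /circle /= -cmodE normrM normfV normr_id divff// normr_eq0.
  move: r01; rewrite in_itv/= => /andP[r0 r1].
  by rewrite cmodM cmod_real ger0_norm// /cmod w1 mulr1.
apply: continuous_compact; last first.
  by apply: compact_setX; [exact: segment_compact|exact: compact_circle].
apply: continuous_subspaceT => -[r w].
apply: cvgM; last exact: cvg_snd.
apply: (@cvg_comp _ _ _ fst (real_complex R)); first exact: cvg_fst.
by apply: cvg_complex; [exact: cvg_id|exact: cvg_cst].
Qed.

(** On the open right half-plane the arctangent is a continuous branch of the argument; it is the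
    only branch that the winding argument needs. *)
Lemma polar_right z : 0 < complex.Re z ->
  z = (cmod z)%:C%C * expi (atan (complex.Im z / complex.Re z)).
Proof.
case: z => x y /= x0; set a := atan _.
have ca : 0 < cos a by rewrite cos_gt0_pihalf// atan_gtNpi2 atan_ltpi2.
have ta : tan a = y / x by rewrite atanK.
have sa : sin a = y / x * cos a by rewrite -ta /tan divfK// gt_eqF.
have cx : cmod (x +i* y)%C * cos a = x.
  apply: (@pexpIrn _ 2); rewrite ?nnegrE ?mulr_ge0 ?cmod_ge0 ?ltW// exprMn cmod_sqrE/=.
  have := cos2Dsin2 a; rewrite sa => h.
  rewrite -[RHS]mulr1 -h; field; exact: lt0r_neq0.
apply/eqP; rewrite eq_complex /= !mul0r subr0 addr0 cx eqxx/=.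
by rewrite sa mulrCA cx divfK// gt_eqF.
Qed.

End Expi.

(** * A winding number argument in the disc *)

Section Winding.
Context {R : realType}.
Local Notation C := R[i].

(** [1 - cos (2 pi a) = 2 sin (pi a) ^ 2], and [sin (pi a)] is positive for [0 < a < 1]. *)
Lemma expi_eq1_eq0 (a : R) : 0 <= a < 1 -> expi (2 * pi * a) = 1 -> a = 0.
Proof.
move=> /andP[a0 a1] /(congr1 (@complex.Re R)) /= ca.
apply/eqP; rewrite eq_le a0 andbT leNgt; apply/negP => {}a0.
have : 0 < sin (pi * a).
  by rewrite sin_gt0_pi// mulr_gt0 ?pi_gt0//= gtr_pMr// pi_gt0.
have : cos (2 * pi * a) = 1 - 2 * sin (pi * a) ^+ 2.
  by rewrite -mulrA mulr_natl cos_mulr2n cos2sin2; ring.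
rewrite ca => h; rewrite lt_neqAle => /andP[/eqP s0 _]; apply: s0.
by apply/esym/eqP; rewrite -sqrf_eq0; apply/eqP; lra.
Qed.

(* Two values of a continuous branch of the argument along a closed loop differ
   by a multiple of [2 * pi], which [IVT] forces to be [0]. *)
Lemma no_lift_degree1 (chi : R -> R) : continuous chi ->
  (forall t, expi (chi t) = expi (chi 0)) -> chi (2 * pi) = chi 0 + 2 * pi ->
  False.
Proof.
move=> cchi cst per; have pi0 := @pi_gt0 R.
have le2 : 0 <= 2 * pi :> R by lra.
have [//|/=|t _ chit] := @IVT R chi 0 (2 * pi) (chi 0 + pi) le2.
- by apply: continuous_subspaceT; exact: cchi.
- rewrite per; apply/andP; split.
    by rewrite ge_min; apply/orP; left; lra.
  by rewrite le_max; apply/orP; right; lra.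
- have := cst t; rewrite chit expiD expi_pi mulrN1 => /eqP.
  rewrite eq_sym -addr_eq0 -mulr2n mulrn_eq0/=.
  by rewrite (negbTE (expi_neq0 _)).
Qed.

(** For [d = 0] the real part is [|G z|^2 > 0]; compactness of the disc makes the admissible size of
    [d] independent of [z]. *)
Lemma disc_uniform_turn (G : C -> C) : continuous G ->
  (forall z, cmod z <= 1 -> G z != 0) ->
  exists2 e, 0 < e & forall d z, cmod d < e -> cmod z <= 1 ->
    0 < complex.Re (G (z + d) * conjc (G z)).
Proof.
move=> cG G0.
have /compact_near_coveringP/(_ _ (nbhs (0 : C))
  (fun d z => 0 < complex.Re (G (z + d) * conjc (G z)))) := @compact_disc R.
move=> /(_ (nbhs_filter _)) [].
  move=> z /= z1.
  have : 0 < complex.Re (G (z + 0) * conjc (G z)).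
    rewrite addr0 mulcJ /= exprn_gt0// lt_neqAle cmod_ge0 andbT eq_sym.
    by apply: contra (G0 z z1) => /eqP/cmod_eq0 ->.
  pose f (zd : C * C) := complex.Re (G (zd.1 + zd.2) * conjc (G zd.1)).
  have cf : continuous f.
    apply: (continuous_compose (f := fun zd : C * C => G (zd.1 + zd.2) * conjc (G zd.1))
      _ (@continuous_Re R)).
    move=> zd; apply: cvgM.
      apply: (continuous_compose (f := fun zd : C * C => zd.1 + zd.2) _ cG).
      by move=> zd'; apply: cvgD; [exact: cvg_fst|exact: cvg_snd].
    apply: (continuous_compose (f := fun zd : C * C => G zd.1) _ (@continuous_conjc R)).
    by apply: (continuous_compose (f := fst) _ cG); move=> zd'; exact: cvg_fst.
  move=> f0; have : \forall zd \near (z, 0 : C), 0 < f zd.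
    exact: (cf (z, 0) _ (lt_nbhsr f0)).
  by [].
move=> e /=; rewrite ltcE /= => /andP[/eqP ei e0] he.
exists (complex.Re e) => // d z de z1.
apply: (he d) => //=.
by rewrite sub0r normrN cmodE [e]complexE ei mulr0 addr0 ltcR.
Qed.

(* If [G] had no zero, its values on the unit circle would be [G 0] times a
   product of ratios of values at consecutive radii [k / N.+1]; each ratio has a
   positive real part, so the argument is a finite sum of arctangents. *)
Lemma winding_zero (G : C -> C) : continuous G ->
  (forall z, `|z| = 1 -> 0 < complex.Re (G z * conjc z)) ->
  exists2 z, cmod z <= 1 & G z = 0.
Proof.
move=> cG Gpos; apply: contrapT => noz.
have G0 z : cmod z <= 1 -> G z != 0.
  by move=> z1; apply/negP => /eqP Gz; apply: noz; exists z.
have [e e0 turn] := disc_uniform_turn cG G0.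
have [N Ne] : exists N : nat, N.+1%:R^-1 < e.
  by have [N _ /(_ N (leqnn N)) HN] := near_infty_natSinv_lt (PosNum e0); exists N.
pose P k t : C := (k%:R / N.+1%:R)%:C%C * expi t.
have P1 k t : (k <= N.+1)%N -> cmod (P k t) <= 1.
  move=> kN; rewrite /P cmodM cmod_expi mulr1 cmod_real ger0_norm ?divr_ge0//.
  by rewrite ler_pdivrMr// mul1r ler_nat.
(* This is the ratio of the values at consecutive radii times [|G (P k t)|^2], hence with the same
   argument and without division. *)
pose w k t := G (P k.+1 t) * conjc (G (P k t)).
have w0 k t : (k < N.+1)%N -> 0 < complex.Re (w k t).
  move=> kN; rewrite /w.
  have -> : P k.+1 t = P k t + (N.+1%:R^-1)%:C%C * expi t.
    by rewrite /P -mulrDl -rmorphD /= -natr1 mulrDl mul1r.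
  apply: turn; last by apply: P1; exact: ltnW.
  by rewrite cmodM cmod_expi mulr1 cmod_real ger0_norm.
have cP k : continuous (P k).
  by move=> t; apply: cvgM; [exact: cvg_cst|exact: continuous_expi].
have cw k : continuous (w k).
  move=> t; apply: cvgM.
    by apply: (@continuous_comp _ _ _ (P k.+1) G); [exact: cP|exact: cG].
  apply: (@continuous_comp _ _ _ (fun t => G (P k t)) (@conjc R)).
    by apply: (@continuous_comp _ _ _ (P k) G); [exact: cP|exact: cG].
  exact: continuous_conjc.
pose arg (h : R -> C) t := atan (complex.Im (h t) / complex.Re (h t)).
have carg h : continuous h -> (forall t, 0 < complex.Re (h t)) ->
    continuous (arg h).
  move=> ch h0 t.
  apply: (@continuous_comp _ _ _ (fun t => complex.Im (h t) / complex.Re (h t)));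
    last exact: continuous_atan.
  apply: cvgM.
    by apply: (@continuous_comp _ _ _ h); [exact: ch|exact: continuous_Im].
  apply: cvgV; first exact: lt0r_neq0.
  by apply: (@continuous_comp _ _ _ h); [exact: ch|exact: continuous_Re].
(* [th] is an argument of the value at radius 1 relative to [G 0]. The induction starts at radius 0,
   where [P 0 t = 0] and [th] is 0, and adds one arctangent per radius. Periodicity holds because
   [t] enters only through [expi t]. *)
have [th [cth thper thE]] : exists th : R -> R, [/\ continuous th,
    th (2 * pi) = th 0 & forall t, exists2 r, 0 < r &
      G (P N.+1 t) = r%:C%C * G 0 * expi (th t)].
  have : (N.+1 <= N.+1)%N by [].
  elim: {-2}N.+1 => [_|k IH kN].
    exists (fun=> 0); split=> // [t|t]; first exact: cvg_cst.
    by exists 1; rewrite // /P !mul0r expi0 mul1r mulr1.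
  have [th [cth thper thE]] := IH (ltnW kN).
  exists (fun t => th t + arg (w k) t); split.
  - by move=> t; apply: cvgD; [exact: cth|apply: carg => // s; exact: w0].
  - by rewrite thper /arg /w /P -[2 * pi]add0r expiD2pi.
  - move=> t; have [r r0 Gr] := thE t.
    have Gk : 0 < cmod (G (P k t)).
      rewrite lt_neqAle cmod_ge0 andbT eq_sym.
      by apply: contra (G0 _ (P1 k t (ltnW kN))) => /eqP/cmod_eq0 ->.
    have wk : 0 < cmod (w k t) by apply: lt_le_trans (w0 k t kN) (le_trans (ler_norm _) (cmod_Re _)).
    exists (cmod (w k t) * r / cmod (G (P k t)) ^+ 2).
      by rewrite divr_gt0 ?exprn_gt0// mulr_gt0.
    have c0 : (cmod (G (P k t)) ^+ 2)%:C%C != 0 :> C.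
      by rewrite eq_complex /= negb_and gt_eqF// exprn_gt0.
    apply: (mulIf c0).
    have -> : G (P k.+1 t) * (cmod (G (P k t)) ^+ 2)%:C%C = w k t * G (P k t).
      by rewrite -mulcJ /w; ring.
    move: (cmod (G (P k t)) ^+ 2) c0 => c c0.
    rewrite {1}(polar_right (w0 k t kN)) Gr expiD -/(arg (w k) t).
    by rewrite !rmorphM fmorphV /=; field.
have hpos t : 0 < complex.Re (G (P N.+1 t) * conjc (expi t)).
  have -> : P N.+1 t = expi t by rewrite /P divff// mul1r.
  by apply: Gpos; exact: norm_expi.
pose h t := G (P N.+1 t) * conjc (expi t).
have ch : continuous h.
  move=> t; apply: cvgM.
    by apply: (@continuous_comp _ _ _ (P N.+1) G); [exact: cP|exact: cG].
  apply: (@continuous_comp _ _ _ (@expi R) (@conjc R)); first exact: continuous_expi.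
  exact: continuous_conjc.
(* Both [t + arg h t] and an argument of [G 0] plus [th t] are arguments of [G (expi t)]. So [chi]
   is a continuous argument of the constant [G 0], although it grows by [2 * pi] over one turn. *)
pose chi t := t - th t + arg h t.
have cchi : continuous chi.
  move=> t; apply: cvgD; last exact: carg.
  by apply: cvgB; [exact: cvg_id|exact: cth].
have chiE t : (cmod (G 0))%:C%C * expi (chi t) = G 0.
  have [r r0 Gr] := thE t.
  have : G (P N.+1 t) = (cmod (h t))%:C%C * expi (t + arg h t).
    rewrite addrC expiD mulrA -(polar_right (hpos t)) /h -mulrA -expiN expiNK.
    by rewrite mulr1.
  rewrite Gr => e1.
  have e2 : r%:C%C * G 0 = (cmod (h t))%:C%C * expi (chi t).
    have -> : chi t = - th t + (t + arg h t) by rewrite /chi; ring.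
    by rewrite expiD mulrCA -e1 mulrCA expiNK mulr1.
  have nr : cmod (h t) = r * cmod (G 0).
    move/(congr1 cmod) : e2 (cmod_ge0 (h t)); move: (cmod (h t)) => a.
    by rewrite !cmodM cmod_expi mulr1 !cmod_real gtr0_norm// => -> /ger0_norm.
  have r0C : r%:C%C != 0 :> C by rewrite eq_complex /= negb_and gt_eqF.
  by apply: (mulfI r0C); rewrite e2 nr rmorphM mulrA.
apply: (no_lift_degree1 cchi).
  move=> t; apply: (@mulfI _ (cmod (G 0))%:C%C); last by rewrite !chiE.
  rewrite eq_complex /= negb_and; apply/orP; left.
  by apply: contra (G0 0 _) => [/eqP/cmod_eq0 ->//|]; rewrite cmod0.
have h2pi : h (2 * pi) = h 0 by rewrite /h /P expi_2pi expi0.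
rewrite /chi thper (_ : arg h (2 * pi) = arg h 0); first by ring.
by rewrite /arg h2pi.
Qed.

End Winding.

(** * Covariant representations *)

Section StarHom.
Context {R : realType}.
Implicit Types A B D : cstarAlgType R.

Lemma star1 A : star (1 : A) = 1.
Proof. by rewrite -[LHS]mulr1 -{2}(starK (1 : A)) -starM mulr1 starK. Qed.

Lemma starX A (a : A) n : star (a ^+ n) = star a ^+ n.
Proof. by elim: n => [|n IH]; rewrite ?expr0 ?star1// exprS starM IH exprSr. Qed.

(** Positivity follows from the triangle inequality: [0 = |a - a| <= 2 |a|]. *)
Lemma cnorm_ge0 A (a : A) : 0 <= cnorm a.
Proof.
have : cnorm (0 : A) <= cnorm a + cnorm a.
  rewrite -[X in cnorm X](subrr a) (le_trans (cnormD _ _))// lerD2l.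
  by rewrite -scaleN1r cnormZ normrN1 mul1r.
rewrite -(scale0r (0 : A)) cnormZ normr0 mul0r -mulr2n.
by rewrite pmulrn_lge0.
Qed.

Section HomTheory.
Variables (A B : cstarAlgType R) (f : A -> B).
Hypothesis fhom : star_hom f.

Lemma homD a b : f (a + b) = f a + f b.
Proof. by have [fl _ _] := fhom; have := fl 1 a b; rewrite !scale1r. Qed.

Lemma hom0 : f 0 = 0.
Proof. by apply: (addrI (f 0)); rewrite -homD !addr0. Qed.

Lemma homZ c a : f (c *: a) = c *: f a.
Proof. by have [fl _ _] := fhom; have := fl c a 0; rewrite addr0 hom0 addr0. Qed.

Lemma homM a b : f (a * b) = f a * f b.
Proof. by have [_ [_ fM] _] := fhom. Qed.

Lemma hom1 : f 1 = 1.
Proof. by have [_ [f1 _] _] := fhom. Qed.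

Lemma hom_star a : f (star a) = star (f a).
Proof. by have [_ _ ->] := fhom. Qed.

Lemma homX a n : f (a ^+ n) = f a ^+ n.
Proof. by elim: n => [|n IH]; rewrite ?expr0 ?hom1// !exprS homM IH. Qed.

End HomTheory.

Lemma star_hom_comp A B D (f : A -> B) (g : B -> D) :
  star_hom f -> star_hom g -> star_hom (g \o f).
Proof.
move=> fh gh; split=> [c a b||a] /=.
- by rewrite (homD fh) (homZ fh) (homD gh) (homZ gh).
- by split=> [|a b] /=; rewrite ?(hom1 fh, hom1 gh)// (homM fh) (homM gh).
- by rewrite (hom_star fh) (hom_star gh).
Qed.

Lemma star_hom_can A B (f : A -> B) (g : B -> A) :
  cancel f g -> cancel g f -> star_hom f -> star_hom g.
Proof.
move=> fK gK fh; split=> [c a b||a].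
- by apply: (can_inj fK); rewrite (homD fh) (homZ fh) !gK.
- split=> [|a b]; apply: (can_inj fK); rewrite gK ?(hom1 fh)//.
  by rewrite (homM fh) !gK.
- by apply: (can_inj fK); rewrite (hom_star fh) !gK.
Qed.

End StarHom.

Section Covariant.
Context {R : realType} {X : topologicalType} (h : homeo X).
Local Notation CX := (continuousType X R[i]).
Implicit Types A B : cstarAlgType R.

Lemma covariant_rep0 A (rho : CX -> A) U : covariant_rep h rho U -> rho 0 = 0.
Proof.
move=> cov; apply: (addrI (rho 0)).
by have := rho_linear cov 1 0 0; rewrite !scale1r !addr0 => <-.
Qed.

Lemma covariant_repZ A (rho : CX -> A) U c f :
  covariant_rep h rho U -> rho (c *: f) = c *: rho f.
Proof.
move=> cov; have := rho_linear cov c f 0.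
by rewrite addr0 (covariant_rep0 cov) addr0.
Qed.

Lemma covariant_rep_comp A B (rho : CX -> A) U (f : A -> B) :
  covariant_rep h rho U -> star_hom f -> covariant_rep h (f \o rho) (f \o U).
Proof.
move=> [rl [r1 rM] rs U0 UD Us Uc] fh; split=> /=.
- by move=> c a b /=; rewrite rl (homD fh) (homZ fh).
- by split=> [|a b] /=; rewrite ?r1 ?(hom1 fh)// rM (homM fh).
- by move=> a; rewrite rs (hom_star fh).
- by rewrite U0 (hom1 fh).
- by move=> m n; rewrite UD (homM fh).
- by move=> n; rewrite -(hom_star fh) Us.
- by move=> n a; rewrite -(hom_star fh) -!(homM fh) Uc.
Qed.

Lemma covariant_rep_unitary_ext A (rho rho' : CX -> A) U U' :
  covariant_rep h rho U -> covariant_rep h rho' U' -> U 1 = U' 1 -> U =1 U'.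
Proof.
move=> Uc Uc' U1; elim/int_ind=> [|n IH|n IH].
- by rewrite (U_0 Uc) (U_0 Uc').
- by rewrite intS (U_D Uc) (U_D Uc') IH U1.
- rewrite intS opprD (U_D Uc) (U_D Uc') IH.
  by rewrite -(U_star Uc 1) -(U_star Uc' 1) U1.
Qed.

Section OfUnitary.
Variables (A : cstarAlgType R) (rho : CX -> A) (V : A).
Hypotheses (rl : linear rho) (rm : monoid_morphism rho).
Hypothesis rs : forall f, rho (ctsJ f) = star (rho f).
Hypotheses (VK : V * star V = 1) (VVK : star V * V = 1).
Hypothesis Vcov : forall f, V * rho f * star V = rho (cts_action h 1 f).

Definition zpow (n : int) : A :=
  match n with Posz n => V ^+ n | Negz n => star V ^+ n.+1 end.

Lemma zpow1 : zpow 1 = V. Proof. exact: expr1. Qed.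

Let zpowS n : zpow (n + 1) = zpow n * V.
Proof.
case: n => [n|[|n]].
- by rewrite addrC -intS /= exprSr.
- by rewrite /= expr1 VVK.
- have -> : Negz n.+1 + 1 = Negz n by rewrite !NegzE (intS n.+1); ring.
  by rewrite /= [in RHS]exprSr -mulrA VVK mulr1.
Qed.

Let zpowB n : zpow (n - 1) = zpow n * star V.
Proof. by rewrite -[n in RHS](subrK 1) zpowS -mulrA VK mulr1. Qed.

Let zpowD m n : zpow (m + n) = zpow m * zpow n.
Proof.
elim/int_ind: n => [|n IH|n IH]; first by rewrite addr0 mulr1.
  by rewrite intS [1 + _]addrC addrA !zpowS IH mulrA.
by rewrite intS [1 + _]addrC opprD addrA !zpowB IH mulrA.
Qed.

Let zpow_star n : star (zpow n) = zpow (- n).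
Proof.
case: n => [[|n]|n] /=; first exact: star1.
  by rewrite starX.
by rewrite starX starK.
Qed.

Let hiterS n x : hiter h (n + 1) x = h (hiter h n x).
Proof.
case: n => [n|[|n]]; first by rewrite addrC -intS.
  by rewrite /= hinvK.
have -> : Negz n.+1 + 1 = Negz n by rewrite !NegzE (intS n.+1); ring.
by rewrite /= hinvK.
Qed.

Let hiterB n x : hiter h (n - 1) x = hinv h (hiter h n x).
Proof. by rewrite -[n in RHS](subrK 1) hiterS hfunK. Qed.

(** Covariance for the inverse generator: apply [Vcov] to [cts_action h (-1) f] and undo the
    conjugation. *)
Let Vcov' f : star V * rho f * V = rho (cts_action h (-1) f).
Proof.
have {1}-> : f = cts_action h 1 (cts_action h (-1) f).
  by apply/continuousEP => x; exact: (congr1 f (esym (hinvK h x))).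
by rewrite -Vcov !mulrA VVK mul1r -mulrA VVK mulr1.
Qed.

Let zpow_cov n f : zpow n * rho f * star (zpow n) = rho (cts_action h n f).
Proof.
elim/int_ind: n f => [|n IH|n IH] f.
- rewrite /= expr0 star1 mul1r mulr1; congr (rho _).
  by apply/continuousEP => x.
- rewrite intS addrC zpowS starM !mulrA -(mulrA (zpow n)) -(mulrA (zpow n)).
  rewrite Vcov IH; congr (rho _); apply/continuousEP => x /=; congr (f _).
  change (hinv h (hiter h (- n%:Z) x) = hiter h (- (n%:Z + 1)) x).
  by rewrite opprD hiterB.
- rewrite intS addrC opprD zpowB starM starK !mulrA.
  rewrite -(mulrA (zpow _)) -(mulrA (zpow _)) Vcov' IH.
  congr (rho _); apply/continuousEP => x /=; congr (f _).
  change (h (hiter h (- (- n%:Z)) x) = hiter h (- (- n%:Z - 1)) x).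
  by rewrite opprB addrC opprK hiterS.
Qed.

(** Covariance under the generator of the integers propagates to all powers, so a representation is
    given by [rho] and one unitary. *)
Lemma covariant_rep_of_unitary : covariant_rep h rho zpow.
Proof. by split=> //; exact: zpow_star. Qed.

End OfUnitary.

(** Both maps solve the universal problem for the covariant pair obtained by composing with [f], and
    its solution is unique. The value at [iZ 1] fixes all values at [iZ n]. *)
Lemma crossed_product_hom_ext A B (iX : CX -> A) iZ (f g : A -> B) :
  covariant_rep h iX iZ ->
  (forall (rho : CX -> B) V, covariant_rep h rho V -> exists! Phi : A -> B,
     [/\ star_hom Phi, forall a, Phi (iX a) = rho a & forall n, Phi (iZ n) = V n]) ->
  star_hom f -> star_hom g -> (forall a, f (iX a) = g (iX a)) ->
  f (iZ 1) = g (iZ 1) -> f = g.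
Proof.
move=> ic univ fh gh fgX fgZ.
have [F [_ Funiq]] := univ _ _ (covariant_rep_comp ic fh).
rewrite -(Funiq f); last by split.
rewrite -(Funiq g)//; split=> // [a|n]; first exact/esym/fgX.
exact: (covariant_rep_unitary_ext (covariant_rep_comp ic gh) (covariant_rep_comp ic fh)).
Qed.

End Covariant.

(** * Contractivity of unital *-homomorphisms on [C(X)] *)

Section Contraction.
Context {R : realType} {X : topologicalType}.
Local Notation C := R[i].
Local Notation CX := (continuousType X R[i]).
Variables (A : cstarAlgType R) (rho : CX -> A).
Hypotheses (rl : linear rho) (rm : monoid_morphism rho).
Hypothesis rs : forall f, rho (ctsJ f) = star (rho f).

Let rhoD f g : rho (f + g) = rho f + rho g.
Proof. by have := rl 1 f g; rewrite !scale1r. Qed.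

Let rho0 : rho 0 = 0.
Proof. by apply: (addrI (rho 0)); rewrite -rhoD !addr0. Qed.

Let rhoZ c f : rho (c *: f) = c *: rho f.
Proof. by have := rl c f 0; rewrite addr0 rho0 addr0. Qed.

(** The C*-identity gives [|1| = |1|^2]. *)
Lemma cnorm1_le : cnorm (1 : A) <= 1.
Proof.
have := cnorm_star (1 : A); rewrite star1 mulr1.
have := cnorm_ge0 (1 : A); rewrite le_eqVlt => /predU1P[<- _|n0]; first exact: ler01.
by rewrite expr2 -{1}[cnorm 1]mulr1 => /(mulfI (lt0r_neq0 n0)) <-.
Qed.

Lemma cnorm_rho_unitary (w : CX) : ctsM (ctsJ w) w = ctsC 1 -> cnorm (rho w) <= 1.
Proof.
move=> w1; rewrite -ler_sqr ?nnegrE ?cnorm_ge0// -cnorm_star expr1n.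
have -> : star (rho w) * rho w = 1; last by rewrite cnorm1_le.
have [r1 rM] := rm; rewrite -rs -rM -r1; exact: (congr1 rho w1).
Qed.

(* A real function [a] with values in [[0, 1]] is the mean of the unitaries
   [a + i sqrt (1 - a ^ 2)] and its conjugate. *)
Lemma cnorm_rho_le (f : CX) (M : R) :
  0 <= M -> (forall x, cmod (f x) <= M) -> cnorm (rho f) <= M.
Proof.
move=> M0 fM; have [r1 rM] := rm.
move: M0; rewrite le_eqVlt => /predU1P[M0|M0].
  suff -> : f = 0 by rewrite rho0 -(scale0r (0 : A)) cnormZ normr0 mul0r M0.
  apply/continuousEP => x; apply: cmod_eq0; apply/le_anti.
  by rewrite cmod_ge0 M0 fM.
(* With this choice [ctsJ f * f] is [M ^ 2] times [a], so a bound on the image of [a] bounds the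
   square of the norm of [rho f] through the C*-identity. *)
pose a x := (cmod (f x) / M) ^+ 2.
have a01 x : 0 <= a x <= 1.
  rewrite sqr_ge0 expr_le1// ?divr_ge0 ?cmod_ge0 ?(ltW M0)//.
  by rewrite ler_pdivrMr// mul1r fM.
have ca : continuous a.
  have cf : continuous (fun x => cmod (f x)).
    by apply: continuous_compose; [exact: cts_fun|exact: continuous_cmod].
  apply: (continuous_compose (f := fun x => cmod (f x) / M) _ (@exprn_continuous R 2)) => x.
  by apply: cvgM; [exact: cf|exact: cvg_cst].
have cw : continuous (fun x => (a x +i* Num.sqrt (1 - a x ^+ 2))%C).
  move=> x; apply: cvg_complex; first exact: ca.
  apply: (continuous_compose (f := fun x => 1 - a x ^+ 2) _ (@sqrt_continuous R)) => y.
  apply: cvgB; first exact: cvg_cst.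
  by apply: (continuous_compose ca (@exprn_continuous R 2)).
pose w : CX := mkcts cw.
have ww : ctsM (ctsJ w) w = ctsC 1.
  apply/continuousEP => x; change (conjc (w x) * w x = 1).
  rewrite mulrC mulcJ cmod_sqrE /= sqr_sqrtr; first by rewrite addrCA subrr addr0.
  have /andP[a0 a1] := a01 x.
  by rewrite subr_ge0 expr_le1.
have ff : ctsM (ctsJ f) f = (2^-1 * (M ^+ 2)%:C%C) *: (w + ctsJ w).
  apply/continuousEP => x; change (conjc (f x) * f x =
    (2^-1 * (M ^+ 2)%:C%C) * (w x + conjc (w x))).
  rewrite addcJ mulrACA mulVf ?pnatr_eq0// mul1r mulrC mulcJ.
  rewrite -rmorphM /=; congr (_%:C%C).
  by rewrite /a exprMn exprVn mulrC divfK// sqrf_eq0 gt_eqF.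
have w1 := cnorm_rho_unitary ww.
have wJ1 : cnorm (rho (ctsJ w)) <= 1.
  apply: cnorm_rho_unitary; rewrite -ww.
  apply/continuousEP => x.
  by change (conjc (conjc (w x)) * conjc (w x) = conjc (w x) * w x); rewrite conjcK mulrC.
rewrite -ler_sqr ?nnegrE ?cnorm_ge0 ?(ltW M0)// -cnorm_star -rs -rM.
change (cnorm (rho (ctsM (ctsJ f) f)) <= M ^+ 2).
rewrite ff rhoZ cnormZ -[complex.Re _]/(cmod _).
have -> : 2^-1 * (M ^+ 2)%:C%C = (2^-1 * M ^+ 2)%:C%C :> C.
  by rewrite [RHS]rmorphM [X in _ = X * _]fmorphV rmorph_nat.
have M2 : 0 <= 2^-1 * M ^+ 2 by rewrite mulr_ge0 ?invr_ge0 ?sqr_ge0.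
rewrite cmod_real ger0_norm// rhoD.
have := le_trans (cnormD (rho w) (rho (ctsJ w))) (lerD w1 wJ1).
move=> /(ler_wpM2l M2) /le_trans; apply.
by rewrite -[1 + 1]/(2 : R) mulrAC mulVf ?mul1r ?pnatr_eq0.
Qed.

End Contraction.

(** * Finite-dimensional representations from periodic orbits *)

Section MatrixFamilyMaps.
Context {R : realType} (n : nat).
Local Notation C := R[i].

Section Pull.
Variables (K L : ptopologicalType) (k : L -> K).
Hypothesis ck : continuous k.

Let pull_ok (F : matfam R K n) : matfam_ok (fun l => F (k l) : 'M[C]_n.+1).
Proof.
split=> [i j|]; first exact: (continuous_compose ck (@matfam_continuous _ _ _ F i j)).
by have [c Fc] := matfam_bounded F; exists c => l.
Qed.

(** It serves to freeze a family at one point, to restrict it to the slice [d = 0], and to extend it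
    constantly in [d]. *)
Definition mf_pull (F : matfam R K n) : matfam R L n := Matfam (pull_ok F).

Lemma mf_pullE F l : mf_pull F l = F (k l). Proof. by []. Qed.

Lemma star_hom_pull : star_hom (mf_pull : matfam R K n -> matfam R L n).
Proof.
split=> [c F G||F]; first by apply/matfamP => l.
  by split=> [|F G]; apply/matfamP => l.
by apply/matfamP => l.
Qed.
End Pull.

Section Conjugation.
Variables (K : ptopologicalType) (W : 'M[C]_n.+1).
Hypothesis W1 : hadj W *m W = 1%:M.

Definition mf_conj (F : matfam R K n) : matfam R K n := mfC K W * F * mfC K (hadj W).

Lemma mf_conjE F k : mf_conj F k = W *m F k *m hadj W. Proof. by []. Qed.

Lemma star_hom_conj : star_hom mf_conj.
Proof.
split=> [c F G||F]; first apply/matfamP => l.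
- rewrite mf_conjE !matfamDE !matfamZE !mf_conjE mulmxDr mulmxDl.
  by rewrite -scalemxAr -scalemxAl.
- split=> [|F G]; apply/matfamP => l.
    by rewrite mf_conjE matfam1E mulmx1 mulmx1C.
  rewrite (matfamME (mf_conj F)) !mf_conjE.
  by rewrite matfamME !mulmxA -(mulmxA _ (hadj W) W) W1 mulmx1.
- apply/matfamP => l; rewrite mf_conjE.
  change (W *m hadj ((F : matfam R K n) l) *m hadj W = hadj (W *m (F : matfam R K n) l *m hadj W)).
  by rewrite !hadjM hadjK mulmxA.
Qed.
End Conjugation.

End MatrixFamilyMaps.

Section OrbitRepresentation.
Context {R : realType} {X : topologicalType} (h : homeo X) (n : nat).
Local Notation C := R[i].
Local Notation CX := (continuousType X C).
Hypothesis h_per : forall x, iter n.+1 h x = x.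
Hypothesis bnd : forall f : CX, exists M, forall x, cmod (f x) <= M.
Context (K : ptopologicalType) (gam : K -> X) (t : K -> C).
Hypotheses (cgam : continuous gam) (ct : continuous t).
Hypothesis t1 : forall k, `|t k| = 1.

Lemma iter_hiter_continuous j : continuous (iter j h).
Proof. exact: (hiter_continuous (n := j)). Qed.

Let diag_ok (f : CX) :
  matfam_ok (fun k => diag_mx (\row_(j < n.+1) f (iter j h (gam k))) : 'M[C]_n.+1).
Proof.
split=> [i j|].
  have [ij|ij] := eqVneq i j; last first.
    rewrite (_ : (fun _ => _) = cst 0); first exact: cst_continuous.
    by apply/funext => k; rewrite !mxE (negbTE ij).
  rewrite (_ : (fun _ => _) = (fun k => f (iter j h (gam k)))).
    apply: (continuous_compose _ (@cts_fun _ _ f)).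
    by move=> x; refine (@continuous_compose _ _ _ gam (iter j h) cgam (@iter_hiter_continuous j) x).
  by apply/funext => k; rewrite !mxE ij eqxx.
have [M fM] := bnd f; exists (M *+ n.+1 *+ n.+1) => k.
apply: mbound_of_entries => i j; rewrite !mxE.
have M0 : 0 <= M := le_trans (cmod_ge0 _) (fM (gam k)).
by case: eqP => _; rewrite ?mulr1n ?mulr0n ?cmod0.
Qed.

Definition orbit_diag (f : CX) : matfam R K n := Matfam (diag_ok f).

Lemma orbit_diagE f k : orbit_diag f k = diag_mx (\row_j f (iter j h (gam k))).
Proof. by []. Qed.

(** The inverse of the cyclic successor: conjugation by [perm_mx s] puts the diagonal entry of index
    [s i] at place [i], where the action requires the value of [f] one step earlier on the orbit. *)
Definition back_shift : 'S_n.+1 := ((perm (@ordS_inj n.+1))^-1)%g.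

Lemma back_shift_per : (back_shift ^+ n.+1 = 1)%g.
Proof.
rewrite /back_shift expgVn; apply/eqP; rewrite invg_eq1; apply/eqP/permP => i.
rewrite permX perm1 (eq_iter (permE _)); apply: val_inj => /=.
have -> k : iter k (@ordS n.+1) i = modn (addn i k) n.+1 :> nat.
  elim: k => [|k IH]; first by rewrite addn0 modn_small.
  by rewrite iterS /= IH addnS -addn1 modnDml addn1.
by rewrite -addn1 modnDml addn1 -addnS modnDr modn_small.
Qed.

Let shift_ok : matfam_ok (fun k => t k *: perm_mx back_shift : 'M[C]_n.+1).
Proof.
split=> [i j|].
  rewrite (_ : (fun _ => _) = (fun k => t k * (perm_mx back_shift : 'M[C]_n.+1) i j)).
    by move=> k; apply: cvgM; [exact: ct|exact: cvg_cst].
  by apply/funext => k; rewrite mxE.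
exists (1 *+ n.+1 *+ n.+1) => k; apply: mbound_of_entries => i j.
rewrite !mxE cmodM {1}/cmod t1 /= mul1r.
by case: eqP => _; rewrite ?cmod1 ?cmod0.
Qed.

(** The free phase [t k] gives the second coordinate on the spectrum: the [n.+1]-th power of the
    unitary is the scalar [t k ^+ n.+1]. *)
Definition orbit_shift : matfam R K n := Matfam shift_ok.

Lemma orbit_shiftE k : orbit_shift k = t k *: perm_mx back_shift. Proof. by []. Qed.

Lemma orbit_shiftX k : (orbit_shift k) ^+ n.+1 = (t k ^+ n.+1)%:M.
Proof.
rewrite orbit_shiftE exprZn -[RHS]scalemx1; congr (_ *: _).
have E m : (perm_mx back_shift : 'M[C]_n.+1) ^+ m = perm_mx (back_shift ^+ m)%g.
  by elim: m => [|m IH]; rewrite ?expr0 ?expg0 ?perm_mx1// exprS expgS perm_mxM IH.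
by rewrite E back_shift_per perm_mx1.
Qed.

Let t_conj k : t k * conjc (t k) = 1. Proof. exact: cmod_unimodular. Qed.

Lemma hadj_perm_mx (s : 'S_n.+1) : hadj (perm_mx s : 'M[C]_n.+1) = perm_mx s^-1%g.
Proof. by rewrite /hadj tr_perm_mx map_perm_mx. Qed.

Let shiftK : orbit_shift * star orbit_shift = 1.
Proof.
apply/matfamP => k; change (orbit_shift k *m hadj (orbit_shift k) = 1%:M).
rewrite orbit_shiftE hadjZ hadj_perm_mx -scalemxAl -scalemxAr scalerA t_conj.
by rewrite scale1r -perm_mxM mulgV perm_mx1.
Qed.

Let shiftVK : star orbit_shift * orbit_shift = 1.
Proof.
apply/matfamP => k; apply: mulmx1C; exact: (congr1 (@^~ k) (congr1 (@mf_val _ _ _) shiftK)).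
Qed.

Lemma orbit_covariant : covariant_rep h orbit_diag (zpow orbit_shift).
Proof.
apply: covariant_rep_of_unitary => //.
- move=> c f g; apply/matfamP => k; rewrite matfamDE matfamZE !orbit_diagE.
  by apply/matrixP => i j; rewrite !mxE; case: eqP; rewrite ?mulr1n ?mulr0n ?mulr0 ?addr0.
- split=> [|f g]; apply/matfamP => k; rewrite ?matfamME !orbit_diagE.
    by apply/matrixP => i j; rewrite !mxE.
  by rewrite mulmx_diag; congr diag_mx; apply/matrixP => i j; rewrite !mxE.
- move=> f; apply/matfamP => k.
  change (orbit_diag (ctsJ f) k = hadj (orbit_diag f k)); rewrite !orbit_diagE.
  apply/matrixP => i j; rewrite hadjE !mxE eq_sym.
  by case: eqP => [->|_]; rewrite ?mulr1n ?mulr0n ?rmorph0.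
- move=> f; apply/matfamP => k.
  change (orbit_shift k *m orbit_diag f k *m hadj (orbit_shift k) =
    orbit_diag (cts_action h 1 f) k).
  rewrite orbit_shiftE hadjZ hadj_perm_mx -!scalemxAl -scalemxAr scalerA.
  rewrite t_conj scale1r -row_permE.
  have -> (D : 'M[C]_n.+1) : D *m perm_mx back_shift^-1 = col_perm back_shift D.
    by rewrite col_permE.
  apply/matrixP => i j; rewrite !orbit_diagE !mxE (inj_eq perm_inj).
  case: eqP => // _; rewrite !mulr1n; congr (f _).
  change (iter (back_shift i) h (gam k) = hinv h (iter i h (gam k))).
  apply: (can_inj (hfunK h)); rewrite hinvK -iterS.
  have {2}<- : ordS (back_shift i) = i.
    by rewrite -(permE (@ordS_inj n.+1)) /back_shift permKV.
  rewrite /=; move: (back_shift i) => m.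
  (* At the last index the shift wraps around to 0, and the periodicity of [h] closes the orbit. *)
  case: (ltngtP m n) => [mn||->]; first by rewrite modn_small.
    by rewrite ltnNge -ltnS ltn_ord.
  by rewrite modnn; exact: h_per.
Qed.

End OrbitRepresentation.

(** * Pairs of unitaries commuting up to a root of unity *)

Section WeylPairs.
Context {R : realType} (n : nat).
Local Notation C := R[i].
Local Notation M := 'M[C]_n.+1.
Variables (w : C) (U V : M).
Hypothesis w_prim : n.+1.-primitive_root w.
Hypotheses (U1 : hadj U *m U = 1%:M) (V1 : hadj V *m V = 1%:M).
Hypothesis UV : U *m V = w *: (V *m U).

Lemma vnorm_isometry (A : M) (x : 'cV[C]_n.+1) :
  hadj A *m A = 1%:M -> vnorm (A *m x) = vnorm x.
Proof.
move=> A1; apply: (@pexpIrn _ 2); rewrite ?nnegrE ?vnorm_ge0//.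
by apply: complexI; rewrite -!vdot_sqr vdotMr mulmxA A1 mul1mx.
Qed.

Lemma exists_unit_eigenvector :
  exists lam (x : 'cV[C]_n.+1), vnorm x = 1 /\ U *m x = lam *: x.
Proof.
(* The transpose appears because [eigenvalueP] produces row vectors. *)
have /closed_rootP[lam] : size (char_poly U^T) != 1 by rewrite size_char_poly.
rewrite -eigenvalue_root_char => /eigenvalueP[v vU v0].
have v1 : vnorm v^T != 0.
  by apply: contra_neq v0 => /vnorm_eq0/(congr1 trmx); rewrite trmxK trmx0.
exists lam, ((vnorm v^T)^-1%:C%C *: v^T); split.
  by rewrite vnormZ cmod_real ger0_norm ?invr_ge0 ?vnorm_ge0// mulVf.
rewrite -scalemxAr scalerA mulrC -scalerA; congr (_ *: _).
by rewrite -linearZ /= -vU trmx_mul trmxK.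
Qed.

Section Eigenbasis.
Variables (lam : C) (x : 'cV[C]_n.+1).
Hypotheses (x1 : vnorm x = 1) (Ux : U *m x = lam *: x).

Lemma eigenvalue_unimodular : conjc lam * lam = 1.
Proof.
have : vdot (U *m x) (U *m x) = 1 by rewrite vdot_sqr vnorm_isometry// x1 expr1n.
by rewrite Ux vdotZl vdotZr vdot_sqr x1 expr1n mulr1.
Qed.

Lemma eigenvalue_norm : `|lam| = 1.
Proof.
apply/eqP; rewrite -(@pexpr_eq1 _ _ 2)// sqr_normc mulrC.
exact/eqP/eigenvalue_unimodular.
Qed.

Lemma vnorm_chain j : vnorm (V ^+ j *m x) = 1.
Proof.
elim: j => [|j IH]; first by rewrite expr0 mul1mx.
by rewrite exprS -mulmxE -mulmxA vnorm_isometry.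
Qed.

(** The relation [U V = w V U] makes [V] carry an eigenvector of [U] to one whose eigenvalue is
    multiplied by [w]. *)
Lemma eigen_chain j : U *m (V ^+ j *m x) = (lam * w ^+ j) *: (V ^+ j *m x).
Proof.
elim: j => [|j IH]; first by rewrite expr0 mul1mx mulr1.
rewrite exprS -mulmxE -mulmxA mulmxA UV -scalemxAl -mulmxA IH.
by rewrite -scalemxAr scalerA exprS mulrCA.
Qed.

(** As [U] is an isometry, the inner product of [y] and [z] is unchanged when multiplied by
    [conjc a * b]. *)
Lemma eigen_orthogonal a b (y z : 'cV[C]_n.+1) :
  U *m y = a *: y -> U *m z = b *: z -> conjc a * b != 1 -> vdot y z = 0.
Proof.
move=> Uy Uz ab; apply/eqP.
have /eqP : vdot (U *m y) (U *m z) = vdot y z by rewrite vdotMr mulmxA U1 mul1mx.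
rewrite Uy Uz vdotZl vdotZr mulrA -{2}[vdot y z]mul1r -subr_eq0 -mulrBl mulf_eq0.
by rewrite subr_eq0 (negbTE ab).
Qed.

Let w0 : w != 0.
Proof.
apply/eqP => w0; have := prim_expr_order w_prim.
by rewrite w0 expr0n /= => /eqP; rewrite eq_sym oner_eq0.
Qed.

Let w_norm : `|w| = 1.
Proof.
apply/eqP; rewrite -(@pexpr_eq1 _ _ n.+1)// -normrX (prim_expr_order w_prim).
by rewrite normr1.
Qed.

Let wJ : conjc w * w = 1.
Proof. by rewrite mulrC cmod_unimodular. Qed.

Lemma chain_coefs j k : (j < n.+1)%N -> (k < n.+1)%N ->
  (conjc (lam * w ^+ j) * (lam * w ^+ k) == 1) = (j == k).
Proof.
move=> jn kn; rewrite rmorphM rmorphXn mulrACA eigenvalue_unimodular mul1r.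
have wj : w ^+ j != 0 by rewrite expf_neq0.
rewrite -(inj_eq (mulIf wj)) mul1r mulrAC -exprMn wJ expr1n mul1r.
by rewrite (eq_prim_root_expr w_prim) !modn_small// eq_sym.
Qed.

Definition eigenbasis : M := \matrix_(i, j) (V ^+ j *m x) i 0.

Lemma eigenbasis_entry i j : eigenbasis i j = (V ^+ j *m x) i 0.
Proof. by rewrite /eigenbasis mxE. Qed.

Lemma eigenbasisE (j : 'I_n.+1) : eigenbasis *m delta_mx j 0 = V ^+ j *m x.
Proof. by rewrite -colE; apply/matrixP => i k; rewrite !mxE ord1. Qed.

Lemma hadj_eigenbasisE (y : 'cV[C]_n.+1) j :
  (hadj eigenbasis *m y) j 0 = vdot (V ^+ j *m x) y.
Proof.
by rewrite vdotE mxE; apply: eq_bigr => i _; rewrite hadjE eigenbasis_entry.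
Qed.

(** The [n.+1] eigenvalues [lam * w ^+ j] are distinct because [w] is primitive, so the chain is an
    orthonormal basis. *)
Lemma eigenbasis_unitary : hadj eigenbasis *m eigenbasis = 1%:M.
Proof.
apply/matrixP => i j; rewrite mxE [RHS]mxE.
transitivity (vdot (V ^+ i *m x) (V ^+ j *m x)).
  by rewrite vdotE; apply: eq_bigr => k _; rewrite hadjE !eigenbasis_entry.
have [->|ij] := eqVneq i j; first by rewrite vdot_sqr vnorm_chain expr1n.
apply: (eigen_orthogonal (eigen_chain i) (eigen_chain j)).
by rewrite chain_coefs.
Qed.

Lemma eigenbasis_ext (A B : M) :
  (forall j : 'I_n.+1, A *m (V ^+ j *m x) = B *m (V ^+ j *m x)) -> A = B.
Proof.
move=> AB; suff e : A *m eigenbasis = B *m eigenbasis.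
  rewrite -[A]mulmx1 -[B]mulmx1 -(mulmx1C eigenbasis_unitary) !mulmxA.
  by rewrite e.
apply/matrixP => i j.
have := congr1 (fun y : 'cV[C]_n.+1 => y i 0) (AB j).
by rewrite -!eigenbasisE !mulmxA -!colE !mxE.
Qed.

(** The eigenvalues of [U] are simple: in the eigenbasis every coefficient of [y] other than that of
    [x] vanishes by orthogonality. *)
Lemma eigen_line (y : 'cV[C]_n.+1) : U *m y = lam *: y -> y = vdot x y *: x.
Proof.
move=> Uy; rewrite -[LHS]mul1mx -(mulmx1C eigenbasis_unitary) -mulmxA.
have -> : hadj eigenbasis *m y = vdot x y *: delta_mx ord0 0.
  apply/matrixP => j k; rewrite ord1 hadj_eigenbasisE !mxE eqxx andbT.
  have [->|j0] := eqVneq j ord0; first by rewrite expr0 mul1mx mulr1.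
  rewrite mulr0; apply: (eigen_orthogonal (eigen_chain j) Uy).
  rewrite -[X in _ * X]mulr1 -(expr0 w) chain_coefs//.
by rewrite -scalemxAr eigenbasisE expr0 mul1mx.
Qed.

Lemma unitary_power_scalar : U ^+ n.+1 = (lam ^+ n.+1)%:M.
Proof.
apply: eigenbasis_ext => j; rewrite mul_scalar_mx.
have E m : U ^+ m *m (V ^+ j *m x) = (lam * w ^+ j) ^+ m *: (V ^+ j *m x).
  elim: m => [|m IH]; first by rewrite !expr0 mul1mx scale1r.
  by rewrite exprSr -mulmxE -mulmxA eigen_chain -scalemxAr IH scalerA exprS.
by rewrite E exprMn -exprM mulnC exprM (prim_expr_order w_prim) expr1n mulr1.
Qed.

(** Since [w ^+ n.+1 = 1], the vector [V ^+ n.+1 *m x] is again a [lam]-eigenvector, hence a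
    multiple of [x]; commutation with [V ^+ j] spreads the same scalar over the basis. *)
Lemma shift_power_scalar : V ^+ n.+1 = (vdot x (V ^+ n.+1 *m x))%:M.
Proof.
have e : V ^+ n.+1 *m x = vdot x (V ^+ n.+1 *m x) *: x.
  by apply: eigen_line; rewrite eigen_chain (prim_expr_order w_prim) mulr1.
apply: eigenbasis_ext => j; rewrite mul_scalar_mx mulmxA mulmxE -exprD addnC exprD.
by rewrite -mulmxE -mulmxA {1}e -scalemxAr.
Qed.

End Eigenbasis.
End WeylPairs.

(** * Matrix representations of [C(T)] and their intertwiners *)

Section CircleAlgebra.
Context {R : realType} (n : nat).
Local Notation C := R[i].
Local Notation M := 'M[C]_n.+1.
Local Notation CT := (continuousType (@circle R) C).

Lemma circle_val_continuous : continuous (val : @circle R -> C).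
Proof. exact: initial_continuous. Qed.

Definition zeta : CT := mkcts circle_val_continuous.

Definition circle_elt (z : C) (z1 : `|z| = 1) : @circle R :=
  exist _ z (mem_set (z1 : circle z)).

Section EigenCharacter.
Variable rho : CT -> M.
Hypotheses (rD : forall f g, rho (f + g) = rho f + rho g)
  (rM : forall f g, rho (f * g) = rho f *m rho g)
  (rC : forall c, rho (ctsC c) = c%:M).
Variables (lam : C) (lam1 : `|lam| = 1) (x : 'cV[C]_n.+1).
Hypotheses (x0 : x != 0) (Ux : rho zeta *m x = lam *: x).
Hypothesis line : forall y, rho zeta *m y = lam *: y -> exists c, y = c *: x.

(* If [rho f x = c x] with [c <> f lam], then [|f - c|^2 + |zeta - lam|^2] is
   invertible, yet its image kills [x]. *)
Lemma eigen_character (f : CT) : rho f *m x = f (circle_elt lam1) *: x.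
Proof.
have [c fc] : exists c, rho f *m x = c *: x.
  (* [rho f] commutes with [rho zeta], hence preserves its one-dimensional eigenspace. *)
  apply: line; rewrite mulmxA -rM.
  have -> : zeta * f = f * zeta.
    by apply/continuousEP => z; exact: mulrC.
  by rewrite rM -mulmxA Ux -scalemxAr.
rewrite fc; congr (_ *: _); apply/eqP; apply: contraPT (x0) => cf.
pose d (g : CT) (a : C) : CT := g + ctsC (- a).
have kill (g : CT) a : rho g *m x = a *: x -> rho (ctsJ (d g a) * d g a) *m x = 0.
  move=> ga; rewrite rM -mulmxA rD rC mulmxDl ga mul_scalar_mx scaleNr subrr.
  by rewrite mulmx0.
pose k := ctsJ (d f c) * d f c + ctsJ (d zeta lam) * d zeta lam.
have kx : rho k *m x = 0 by rewrite rD mulmxDl !kill// addr0.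
have kE z : k z = (cmod (f z - c) ^+ 2 + cmod (val z - lam) ^+ 2)%:C%C.
  by rewrite rmorphD /= -!mulcJ ![_ * conjc _]mulrC.
have k0 z : k z != 0.
  rewrite kE eq_complex /= eqxx andbT paddr_eq0 ?sqr_ge0// !sqrf_eq0.
  apply/negP => /andP[/eqP/cmod_eq0 fz /eqP/cmod_eq0 zl].
  move/negP : cf; apply; rewrite (_ : circle_elt lam1 = z).
    by rewrite eq_sym -subr_eq0 fz.
  by apply: val_inj => /=; apply/esym/eqP; rewrite -subr_eq0 zl.
have cV : continuous (fun z => (k z)^-1).
  by move=> z; have FF := nbhs_filter z; apply: cvgV => //; exact: (@cts_fun _ _ (k : CT)).

pose kV : CT := mkcts cV.
have : rho (kV * k) *m x = 0 by rewrite rM -mulmxA kx mulmx0.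
have -> : kV * k = ctsC 1.
  by apply/continuousEP => z; exact: mulVf.
by rewrite rC mul1mx => ->; rewrite eqxx.
Qed.

End EigenCharacter.

Section Intertwiner.
Variables (w : C) (rho1 rho2 : CT -> M) (V1 V2 : M).
Hypothesis w_prim : n.+1.-primitive_root w.
Hypotheses (rD1 : forall f g, rho1 (f + g) = rho1 f + rho1 g)
  (rM1 : forall f g, rho1 (f * g) = rho1 f *m rho1 g)
  (rC1 : forall c, rho1 (ctsC c) = c%:M)
  (rJ1 : forall f, rho1 (ctsJ f) = hadj (rho1 f))
  (V1u : hadj V1 *m V1 = 1%:M)
  (UV1 : rho1 zeta *m V1 = w *: (V1 *m rho1 zeta)).
Hypotheses (rD2 : forall f g, rho2 (f + g) = rho2 f + rho2 g)
  (rM2 : forall f g, rho2 (f * g) = rho2 f *m rho2 g)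
  (rC2 : forall c, rho2 (ctsC c) = c%:M)
  (rJ2 : forall f, rho2 (ctsJ f) = hadj (rho2 f))
  (V2u : hadj V2 *m V2 = 1%:M)
  (UV2 : rho2 zeta *m V2 = w *: (V2 *m rho2 zeta)).

Lemma zeta_unitary (rho : CT -> M) :
  (forall f g, rho (f * g) = rho f *m rho g) ->
  (forall c, rho (ctsC c) = c%:M) ->
  (forall f, rho (ctsJ f) = hadj (rho f)) -> hadj (rho zeta) *m rho zeta = 1%:M.
Proof.
move=> rM rC rJ; rewrite -rJ -rM -rC; congr (rho _).
apply/continuousEP => z; change (conjc (val z) * val z = 1).
by rewrite mulrC cmod_unimodular//; exact: (set_valP z).
Qed.

Let U1u := zeta_unitary rM1 rC1 rJ1.
Let U2u := zeta_unitary rM2 rC2 rJ2.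

(** [W] sends [V1 ^+ j *m x1] to [V2 ^+ j *m x2], where [x1] and [x2] are unit eigenvectors of the
    two images of [zeta] for one common eigenvalue. The first scalar makes a common eigenvalue
    possible, the second makes the two chains close up alike. *)
Lemma exists_intertwiner :
  ((rho1 zeta) ^+ n.+1) 0 0 = ((rho2 zeta) ^+ n.+1) 0 0 ->
  (V1 ^+ n.+1) 0 0 = (V2 ^+ n.+1) 0 0 ->
  exists W : M, [/\ hadj W *m W = 1%:M, W *m V1 = V2 *m W &
    forall f, W *m rho1 f = rho2 f *m W].
Proof.
move=> Uq Vq.
have [lam1 [y1 [y1n Uy1]]] := exists_unit_eigenvector (rho1 zeta).
have [lam [x2 [x2n Ux2]]] := exists_unit_eigenvector (rho2 zeta).
(* Equal [n.+1]-th powers mean that [lam] is [lam1] times a power [w ^+ k], and [V1 ^+ k] moves [y1]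
   to the eigenvalue [lam]. *)
have [x1 x1n Ux1] : exists2 x1, vnorm x1 = 1 & rho1 zeta *m x1 = lam *: x1.
  have l1 : lam1 != 0.
    apply/eqP => l0; have := eigenvalue_unimodular U1u y1n Uy1.
    by rewrite l0 mulr0 => /eqP; rewrite eq_sym oner_eq0.
  have [k kE] : exists k : 'I_n.+1, lam / lam1 = w ^+ k.
    have /(prim_rootP w_prim)[k kE] : (lam / lam1) ^+ n.+1 = 1; last by exists k.
    move: Uq; rewrite (unitary_power_scalar w_prim U1u V1u UV1 y1n Uy1).
    rewrite (unitary_power_scalar w_prim U2u V2u UV2 x2n Ux2) !mxE !mulr1n => e.
    by rewrite exprMn exprVn -e divff// expf_neq0.
  exists (V1 ^+ k *m y1); first by rewrite vnorm_chain.
  by rewrite (eigen_chain UV1 Uy1) -kE mulrC divfK.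
pose P1 := eigenbasis V1 x1; pose P2 := eigenbasis V2 x2.
have P1u := eigenbasis_unitary w_prim U1u V1u UV1 x1n Ux1.
have P2u := eigenbasis_unitary w_prim U2u V2u UV2 x2n Ux2.
have We (j : 'I_n.+1) : P2 *m hadj P1 *m (V1 ^+ j *m x1) = V2 ^+ j *m x2.
  by rewrite -eigenbasisE -mulmxA (mulmxA (hadj P1)) P1u mul1mx eigenbasisE.
have lamw1 j : `|lam * w ^+ j| = 1.
  apply: (eigenvalue_norm U1u (vnorm_chain V1u x1n j)).
  exact: (eigen_chain UV1 Ux1).
have neq0 (x : 'cV[C]_n.+1) : vnorm x = 1 -> x != 0.
  by move=> xn; apply/eqP => x0; move: xn; rewrite x0 vnorm0 => /eqP; rewrite eq_sym oner_eq0.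
have chi1 f j : rho1 f *m (V1 ^+ j *m x1) =
    f (circle_elt (lamw1 j)) *: (V1 ^+ j *m x1).
  apply: eigen_character => //; first by apply/neq0/vnorm_chain.
    exact: (eigen_chain UV1 Ux1).
  move=> y /(eigen_line w_prim U1u V1u UV1 (vnorm_chain V1u x1n j)
    (eigen_chain UV1 Ux1 j)) ->; by eexists.
have chi2 f j : rho2 f *m (V2 ^+ j *m x2) =
    f (circle_elt (lamw1 j)) *: (V2 ^+ j *m x2).
  apply: eigen_character => //; first by apply/neq0/vnorm_chain.
    exact: (eigen_chain UV2 Ux2).
  move=> y /(eigen_line w_prim U2u V2u UV2 (vnorm_chain V2u x2n j)
    (eigen_chain UV2 Ux2 j)) ->; by eexists.
exists (P2 *m hadj P1); split.
- rewrite hadjM hadjK -mulmxA (mulmxA (hadj P2)) P2u mul1mx.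
  exact: mulmx1C.
- apply: (eigenbasis_ext w_prim U1u V1u UV1 x1n Ux1) => j.
  rewrite -[LHS]mulmxA -[RHS]mulmxA We (mulmxA V1) (mulmxA V2) !mulmxE -!exprS -!mulmxE.
  have [jn|] := ltnP j n.
    exact: (We (Ordinal (jn : (j.+1 < n.+1)%N))).
  (* At the end of the chain the next vector is a scalar multiple of the first one; [Vq] says that
     both scalars agree. *)
  move=> nj; have -> : j = n :> nat.
    by apply/eqP; rewrite eqn_leq nj -ltnS ltn_ord.
  have [mu1 e1] : exists mu, V1 ^+ n.+1 = mu%:M.
    by eexists; exact: (shift_power_scalar w_prim U1u V1u UV1 x1n Ux1).
  have [mu2 e2] : exists mu, V2 ^+ n.+1 = mu%:M.
    by eexists; exact: (shift_power_scalar w_prim U2u V2u UV2 x2n Ux2).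
  move: Vq; rewrite e1 e2 !mxE !mulr1n => ->; rewrite !mul_scalar_mx -!scalemxAr.
  by have := We ord0; rewrite !expr0 !mul1mx => ->.
- move=> f; apply: (eigenbasis_ext w_prim U1u V1u UV1 x1n Ux1) => j.
  by rewrite -[LHS]mulmxA chi1 -scalemxAr We -[RHS]mulmxA We chi2.
Qed.

End Intertwiner.
End CircleAlgebra.

(** * Matrix representations of the rational rotation algebra *)

Section RotationAlgebra.
Context {R : realType} (p : int) (n : nat).
Local Notation C := R[i].
Local Notation CT := (continuousType (@circle R) C).
Hypothesis pn : coprimez p n.+1%:Z.

Definition rot_mult : C := expi (rot_angle p n.+1%:Z).
Local Notation w := rot_mult.
Local Notation phi := (homeo_restr (@rotation_circle R p n.+1%:Z)).

Lemma expi_int (d : int) : expi (2 * pi * d%:~R) = 1 :> C.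
Proof.
case: d => d; first by rewrite -pmulrn mulr_natr expiMn expi_2pi expr1n.
by rewrite NegzE mulrNz mulrN expiN -pmulrn mulr_natr expiMn expi_2pi expr1n rmorph1.
Qed.

Lemma rot_multX k : w ^+ k = expi (2 * pi * ((p * k%:Z)%:~R / n.+1%:R)).
Proof.
rewrite /rot_mult -expiMn; congr expi; rewrite /rot_angle.
have N0 : n.+1%:R != 0 :> R by rewrite pnatr_eq0.
by rewrite -(mulr_natr _ k) rmorphM /= -!pmulrn; move: (n.+1%:R) N0 => N N0; field.
Qed.

(** If [w] has order [m], then [n.+1] divides [p * m], hence [m] by coprimality. *)
Lemma rot_mult_prim : n.+1.-primitive_root w.
Proof.
have wn : w ^+ n.+1 = 1.
  by rewrite rot_multX rmorphM /= -!pmulrn mulfK ?pnatr_eq0// expi_int.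
have [m m_prim mn] := prim_order_exists (ltn0Sn n) wn.
suff mE : m = n.+1 by rewrite -mE.
have m0 := prim_order_gt0 m_prim.
apply/eqP; rewrite eqn_leq dvdn_leq//= leqNgt; apply/negP => mlt.
have := prim_expr_order m_prim; rewrite rot_multX.
set pm := p * m%:Z => e.
(* Removing full turns leaves the angle [2 pi r / n.+1] with [r] the remainder, and a fraction in
   [[0, 1)] giving the value 1 must be 0. *)
have r0 : modz pm n.+1%:Z = 0.
  have : expi (2 * pi * ((modz pm n.+1)%:~R / n.+1%:R)) = 1 :> C.
    move: e; rewrite [in LHS](divz_eq pm n.+1%:Z) rmorphD rmorphM /= (mulrDl _ _ n.+1%:R^-1).
    by rewrite -pmulrn mulfK ?pnatr_eq0// (mulrDr (2 * pi)) expiD expi_int mul1r.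
  move=> /expi_eq1_eq0 -/(_ _)/eqP.
  rewrite mulf_eq0 invr_eq0 pnatr_eq0 orbF intr_eq0 => h; apply/eqP/h.
  rewrite divr_ge0 ?ler0z ?modz_ge0//= ltr_pdivrMr// mul1r.
  by rewrite -[n.+1%:R]/(n.+1%:Z%:~R) ltr_int ltz_pmod.
have : (n.+1%:Z %| pm)%Z by exact/dvdz_mod0P.
rewrite /pm Gauss_dvdzr; last by rewrite coprimez_sym.
by rewrite /dvdz /= => /(dvdn_leq m0); rewrite leqNgt mlt.
Qed.

Let w0 : w != 0. Proof. exact: expi_neq0. Qed.

Section Kernel.
Variables (B : cstarAlgType R) (iX : CT -> B) (iZ : int -> B).
Hypothesis cov : covariant_rep phi iX iZ.
Hypothesis univ : forall (D : cstarAlgType R) (rho : CT -> D) (V : int -> D),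
  covariant_rep phi rho V -> exists! Phi : B -> D,
    [/\ star_hom Phi, forall f, Phi (iX f) = rho f & forall n, Phi (iZ n) = V n].

Lemma gen_star_mul : star (iZ 1) * iZ 1 = 1.
Proof. by rewrite (U_star cov) -(U_D cov) addNr (U_0 cov). Qed.

(** The action composes with the inverse rotation, so conjugation by [iZ 1] multiplies [zeta] by
    [w^-1]. *)
Lemma gen_commute : iX zeta * iZ 1 = w *: (iZ 1 * iX zeta).
Proof.
have act : cts_action phi 1 zeta = w^-1 *: zeta.
  by apply/continuousEP => z; exact: mulrC.
have := U_covariant cov 1 zeta; rewrite act (covariant_repZ _ _ cov).
move=> /(congr1 (fun b => w *: (b * iZ 1))).
by rewrite -mulrA gen_star_mul mulr1 -scalerAl scalerA divff// scale1r => ->.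
Qed.

Section AtPoint.
Variables (K : ptopologicalType) (f : B -> matfam R K n) (k : K).
Hypothesis fh : star_hom f.

Definition pt_rho (g : CT) : 'M[C]_n.+1 := (f (iX g) : matfam R K n) k.
Definition pt_V : 'M[C]_n.+1 := (f (iZ 1) : matfam R K n) k.

Lemma pt_rhoD g g' : pt_rho (g + g') = pt_rho g + pt_rho g'.
Proof.
have rl := rho_linear cov 1 g g'; rewrite !scale1r in rl.
by rewrite /pt_rho rl (homD fh).
Qed.

Lemma pt_rhoM g g' : pt_rho (g * g') = pt_rho g *m pt_rho g'.
Proof. by have [_ rM] := rho_monoid cov; rewrite /pt_rho rM (homM fh). Qed.

Lemma pt_rhoC c : pt_rho (ctsC c) = c%:M.
Proof.
have [r1 _] := rho_monoid cov; have -> : ctsC c = c *: (1 : CT).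
  by apply/continuousEP => z; rewrite /= -[LHS]mulr1.
rewrite /pt_rho (covariant_repZ _ _ cov) r1.
by rewrite (homZ fh) (hom1 fh) matfamZE matfam1E scalemx1.
Qed.

Lemma pt_rhoJ g : pt_rho (ctsJ g) = hadj (pt_rho g).
Proof. by rewrite /pt_rho (rho_star cov) (hom_star fh). Qed.

Lemma pt_V_unitary : hadj pt_V *m pt_V = 1%:M.
Proof.
rewrite -(@matfam1E R K n k) -(hom1 fh) -gen_star_mul (homM fh) (hom_star fh).
by [].
Qed.

Lemma pt_commute : pt_rho zeta *m pt_V = w *: (pt_V *m pt_rho zeta).
Proof.
by rewrite /pt_rho /pt_V -!matfamME -matfamZE -!(homM fh) gen_commute (homZ fh).
Qed.

End AtPoint.

(** Equal scalars give a unitary intertwining the generators; uniqueness in the universal property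
    extends this to all of [B], and unitarily equivalent representations have the same kernel. *)
Lemma kernel_of_scalars (K L : ptopologicalType) (f1 : B -> matfam R K n)
    (f2 : B -> matfam R L n) (k1 : K) (k2 : L) : star_hom f1 -> star_hom f2 ->
  (pt_rho f1 k1 zeta ^+ n.+1) 0 0 = (pt_rho f2 k2 zeta ^+ n.+1) 0 0 ->
  (pt_V f1 k1 ^+ n.+1) 0 0 = (pt_V f2 k2 ^+ n.+1) 0 0 ->
  forall b, f1 b k1 = 0 -> f2 b k2 = 0.
Proof.
move=> f1h f2h Uq Vq b fb.
have [W [W1 WV Wr]] := exists_intertwiner rot_mult_prim
  (pt_rhoD k1 f1h) (pt_rhoM k1 f1h) (pt_rhoC k1 f1h) (pt_rhoJ k1 f1h)
  (pt_V_unitary k1 f1h) (pt_commute k1 f1h)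
  (pt_rhoD k2 f2h) (pt_rhoM k2 f2h) (pt_rhoC k2 f2h) (pt_rhoJ k2 f2h)
  (pt_V_unitary k2 f2h) (pt_commute k2 f2h) Uq Vq.
have W1' := mulmx1C W1.
(* Both point representations are spread out as constant families over [L], so that they become
   *-homomorphisms into the same C*-algebra. *)
have c1 : continuous (fun _ : L => k1) by move=> l; exact: cvg_cst.
have c2 : continuous (fun _ : L => k2) by move=> l; exact: cvg_cst.
have F1h := star_hom_comp (star_hom_comp f1h (star_hom_pull n c1)) (star_hom_conj L W1).
have F2h := star_hom_comp f2h (star_hom_pull n c2).
have F12 := crossed_product_hom_ext cov (@univ _) F1h F2h.
have : mf_conj W (mf_pull c1 (f1 b)) = mf_pull c2 (f2 b).
  refine (congr1 (@^~ b) (F12 _ _)).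
    move=> g; apply/matfamP => l.
    change (W *m pt_rho f1 k1 g *m hadj W = pt_rho f2 k2 g).
    by rewrite Wr -mulmxA W1' mulmx1.
  apply/matfamP => l; change (W *m pt_V f1 k1 *m hadj W = pt_V f2 k2).
  by rewrite WV -mulmxA W1' mulmx1.
move=> /(congr1 (fun F : matfam R L n => F point)).
by rewrite mf_conjE !mf_pullE fb mulmx0 mul0mx => <-.
Qed.

End Kernel.
End RotationAlgebra.

(** * Homotopies of the base space *)

Section CompactSubtype.

Lemma compact_set_type (T : topologicalType) (A : set T) :
  compact A -> compact [set: A].
Proof.
move=> cA F FF _.
have FA : ((fun x : A => val x) @ F) A.
  rewrite /fmap /= (_ : _ @^-1` A = setT); first exact: filterT.
  by apply/seteqP; split=> // x _; exact: (set_valP x).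
have [p [Ap clp]] := cA _ (fmap_proper_filter (fun x : A => val x) FF) FA.
exists (exist _ p (mem_set Ap)); split=> // B D FB.
rewrite nbhsE => -[E [[U oU UE] Ep] ED].
have Up : U p by move: Ep; rewrite -UE.
have FB' : ((fun x : A => val x) @ F) ((fun x : A => val x) @` B).
  by apply: (@filterS _ F _ B _ _ FB) => x Bx; exists x.
have [_ [[x Bx <-] Ux]] := clp _ _ FB' (open_nbhs_nbhs (conj oU Up)).
by exists x; split=> //; apply: ED; rewrite -UE.
Qed.

Lemma compact_cmod_bounded (R : realType) (X : topologicalType)
    (f : continuousType X R[i]) :
  compact [set: X] -> exists M, forall x, cmod (f x) <= M.
Proof.
move=> cX.
have : compact ((fun x => cmod (f x)) @` [set: X]).
  apply: continuous_compact cX; apply: continuous_subspaceT.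
  exact: (continuous_compose (@cts_fun _ _ f) (@continuous_cmod R)).
move=> /compact_bounded[M [_ HM]]; exists (M + 1) => x.
rewrite (le_trans (ler_norm _))//.
by have := HM (M + 1); rewrite ltrDl ltr01 => /(_ isT); apply; exists x.
Qed.

(** A tube lemma: positivity on a compact slice persists on nearby slices. *)
Lemma near_pos_compact (R : realType) (Y Z : topologicalType) (G : Y * Z -> R)
    (A : set Z) (y : Y) : continuous G -> compact A ->
  (forall z, A z -> 0 < G (y, z)) ->
  \forall y' \near y, forall z, A z -> 0 < G (y', z).
Proof.
move=> cG /compact_near_coveringP cA G0.
apply: (cA _ (nbhs y) (fun y' z => 0 < G (y', z))) => z Az.
have : \forall yz \near (y, z), 0 < G yz.
  exact: (cG (y, z) _ (lt_nbhsr (G0 z Az))).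
move=> [[U V] /= [Uy Vz] UV]; exists (V, U) => // -[a b] /= [Va Ub].
exact: (UV (b, a)).
Qed.

End CompactSubtype.

Lemma continuous_pairr (Y Z : topologicalType) (y : Y) :
  continuous (fun z : Z => (y, z)).
Proof.
move=> z; apply: (@cvg_pair _ _ _ (nbhs z) (nbhs y) (nbhs z)).
  exact: cvg_cst.
exact: cvg_id.
Qed.

HB.instance Definition _ (A B : ptopologicalType) := Pointed.on (A * B)%type.

Section Homotopy.
Context {R : realType} {X : topologicalType} (h : homeo X) (n : nat).
Local Notation C := R[i].
Local Notation CX := (continuousType X C).
Context (K : ptopologicalType).
Hypothesis cX : compact [set: X].
Variable H : R -> X -> X.
Hypothesis cH : continuous (fun dx : R * X => H dx.1 dx.2).
Hypothesis H0 : forall x, H 0 x = x.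
Hypothesis Hh : forall d x, H d (h x) = h (H d x).

Let H_continuous d : continuous (H d).
Proof.
exact: (continuous_compose (@continuous_pairr R X d) cH).
Qed.

Definition homotope (d : R) (f : CX) : CX := f \o mkcts (@H_continuous d).

Let hiterH d m x : hiter h m (H d x) = H d (hiter h m x).
Proof.
have Hinv y : hinv h (H d y) = H d (hinv h y).
  by apply: (can_inj (hfunK h)); rewrite hinvK -Hh hinvK.
case: m => m /=.
  by elim: m => //= m ->.
by elim: m => [|m /= IH]; rewrite /= ?IH Hinv.
Qed.

Let homotope_action d m f :
  homotope d (cts_action h m f) = cts_action h m (homotope d f).
Proof.
by apply/continuousEP => x; exact: (congr1 f (hiterH d (- m) x)).
Qed.

(** Sup-norm continuity in [d]: the tube lemma is applied to [e] minus the distance between the two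
    values, which equals [e] on the slice [d]. *)
Let homotope_near d f e : 0 < e ->
  \forall d' \near d, forall x, cmod (homotope d' f x - homotope d f x) <= e.
Proof.
move=> e0.
have cG : continuous (fun dx : R * X => e - cmod (f (H dx.1 dx.2) - f (H d dx.2))).
  move=> dx; apply: cvgB; first exact: cvg_cst.
  apply: (continuous_compose (f := fun dx : R * X => f (H dx.1 dx.2) - f (H d dx.2)) _
    (@continuous_cmod R)) => {}dx.
  apply: cvgB; first exact: (continuous_compose cH (@cts_fun _ _ f)).
  apply: (continuous_compose (f := fun dx : R * X => H d dx.2) _ (@cts_fun _ _ f)).
  by apply: (continuous_compose _ (@H_continuous d)) => {}dx; exact: cvg_snd.
have [|r /= r0 hr] := @near_pos_compact R R X _ setT d cG cX.
  by move=> x _ /=; rewrite subrr cmod0 subr0.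
exists r => //= d' /hr hd x.
by apply: ltW; have := hd x I; rewrite subr_gt0.
Qed.

Variables (A : cstarAlgType R) (iX : CX -> A) (iZ : int -> A).
Hypothesis cov : covariant_rep h iX iZ.
Hypothesis univ : forall (D : cstarAlgType R) (rho : CX -> D) (V : int -> D),
  covariant_rep h rho V -> exists! Phi : A -> D,
    [/\ star_hom Phi, forall f, Phi (iX f) = rho f & forall n, Phi (iZ n) = V n].
Variable F : A -> matfam R K n.
Hypothesis Fh : star_hom F.

Let covF := covariant_rep_comp cov Fh.

Let F_le (f : CX) k i j (M : R) : 0 <= M -> (forall x, cmod (f x) <= M) ->
  cmod ((F (iX f) : matfam R K n) k i j) <= M.
Proof.
move=> M0 fM; apply: le_trans (cmod_le_mfnorm _ k i j) _.
exact: (cnorm_rho_le (rho_linear covF) (rho_monoid covF) (rho_star covF) M0 fM).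
Qed.

Let iXB (f g : CX) : iX (f - g) = iX f - iX g.
Proof.
have -> : f - g = (-1) *: g + f by rewrite scaleN1r addrC.
by rewrite (rho_linear cov) scaleN1r addrC.
Qed.

Let hom_ok f :
  matfam_ok (fun dk : R * K => (F (iX (homotope dk.1 f)) : matfam R K n) dk.2).
Proof.
have [M fM] := compact_cmod_bounded f cX.
split=> [i j|]; last first.
  exists (`|M| *+ n.+1 *+ n.+1) => k; apply: mbound_of_entries => i j.
  apply: F_le => // x; exact: le_trans (fM _) (ler_norm _).
move=> [d k]; have FF := nbhs_filter (d, k); apply/cvg_cmodP => e e0 /=.
have e2 : 0 < e / 2 by rewrite divr_gt0.
have near1 := homotope_near d f e2.
have near2 : \forall k' \near k,
    cmod ((F (iX (homotope d f)) : matfam R K n) k i j -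
        (F (iX (homotope d f)) : matfam R K n) k' i j) < e / 2.
  have FFk := nbhs_filter k.
  exact: ((@cvg_cmodP R K (nbhs k) FFk _ _).1
    (@matfam_continuous R K n (F (iX (homotope d f))) i j k) _ e2).
exists ([set d' | forall x, cmod (homotope d' f x - homotope d f x) <= e / 2],
        [set k' | cmod ((F (iX (homotope d f)) : matfam R K n) k i j -
          (F (iX (homotope d f)) : matfam R K n) k' i j) < e / 2]) => //.
move=> [d' k'] /= [hd hk].
pose v a b := (F (iX (homotope a f)) : matfam R K n) b i j.
change (cmod (v d k - v d' k') < e).
(* The first difference is small by continuity of one fixed family. The second is small uniformly in
   [k'], because [F] composed with [iX] is contractive and the two functions are uniformly close. *)
have -> : v d k - v d' k' = (v d k - v d k') + (v d k' - v d' k') by ring.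
rewrite [ltRHS]splitr; apply: le_lt_trans (cmodD _ _) _; apply: ltr_leD => //.
rewrite cmodB /v.
have -> : (F (iX (homotope d' f)) : matfam R K n) k' i j -
    (F (iX (homotope d f)) : matfam R K n) k' i j =
    (F (iX (homotope d' f - homotope d f)) : matfam R K n) k' i j.
  rewrite iXB -[- iX _]scaleN1r (homD Fh) (homZ Fh) matfamDE matfamZE scaleN1r.
  by rewrite !mxE.
by apply: F_le => //; exact: ltW.
Qed.

(** The value at [(d, k)] is the representation at [k] precomposed with the endomorphism of the
    crossed product induced by [H d]. The unitaries do not move, since [H d] commutes with [h]. *)
Lemma homotopy_extension : exists G : A -> matfam R (R * K)%type n,
  [/\ star_hom G, forall a k, G a (0, k) = F a k &
    forall f d k, G (iX f) (d, k) = F (iX (homotope d f)) k].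
Proof.
have csnd : continuous (snd : R * K -> K) by move=> k; exact: cvg_snd.
have c0 : continuous (fun k : K => (0 : R, k)).
  exact: continuous_pairr.
pose rho f : matfam R (R * K)%type n := Matfam (hom_ok f).
pose V m : matfam R (R * K)%type n := mf_pull csnd (F (iZ m)).
have pull_hom : star_hom (mf_pull csnd : matfam R K n -> matfam R (R * K)%type n).
  exact: star_hom_pull.
have cov' := covariant_rep_comp covF pull_hom.
have rhoV : covariant_rep h rho V.
  split.
  - move=> c f g; apply/matfamP => -[d k].
    change (F (iX (homotope d (c *: f + g))) k =
      c *: F (iX (homotope d f)) k + F (iX (homotope d g)) k).
    have -> : homotope d (c *: f + g) = c *: homotope d f + homotope d g.
      by apply/continuousEP.
    by have := rho_linear covF c (homotope d f) (homotope d g) => /= ->.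
  - split=> [|f g]; apply/matfamP => -[d k].
      change (F (iX (homotope d 1)) k = 1%:M).
      have -> : homotope d 1 = 1 by apply/continuousEP.
      by have [/= -> _] := rho_monoid covF.
    change (F (iX (homotope d (f * g))) k =
      F (iX (homotope d f)) k *m F (iX (homotope d g)) k).
    have -> : homotope d (f * g) = homotope d f * homotope d g.
      by apply/continuousEP.
    by have [_ E] := rho_monoid covF; have /= -> := E (homotope d f) (homotope d g).
  - move=> f; apply/matfamP => -[d k].
    change (F (iX (homotope d (ctsJ f))) k = hadj (F (iX (homotope d f)) k)).
    have -> : homotope d (ctsJ f) = ctsJ (homotope d f) by apply/continuousEP.
    by have /= -> := rho_star covF (homotope d f).
  - exact: (U_0 cov').
  - exact: (U_D cov').
  - exact: (U_star cov').
  - move=> m f; apply/matfamP => -[d k].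
    change (F (iZ m) k *m F (iX (homotope d f)) k *m hadj (F (iZ m) k) =
      F (iX (homotope d (cts_action h m f))) k).
    rewrite homotope_action.
    by have /= <- := U_covariant covF m (homotope d f).
have [G [[Gh GX GZ] _]] := univ rhoV.
exists G; split=> // [a k|f d k]; last by rewrite GX.
(* On the slice [d = 0] both sides agree on the generators because [H 0] is the identity. *)
have : mf_pull c0 (G a) = F a.
  have := crossed_product_hom_ext cov (@univ _)
    (star_hom_comp Gh (star_hom_pull n c0)) Fh.
  move=> E; refine (congr1 (@^~ a) (E _ _)) => [f|] /=.
    rewrite GX; apply/matfamP => l; change (F (iX (homotope 0 f)) l = F (iX f) l).
    by have -> : homotope 0 f = f by apply/continuousEP => x; exact: (congr1 f (H0 x)).
  by rewrite GZ; apply/matfamP.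
by move=> <-.
Qed.

End Homotopy.

(** * The circle with whiskers *)

Section Whisker.
Context {R : realType} (p : int) (n : nat).
Local Notation C := R[i].
Local Notation w := (rot_mult p n : C).
Local Notation rot := (@rotation R p n.+1%:Z).
Variable Y : set C.
Hypothesis rotY : rot @` Y = Y.
Hypothesis YE : Y = @circle R `|`
  \bigcup_(k in [set k : nat | (k%:Z < n.+1%:Z)%R])
    iter k rot @` [set (x%:C)%C | x in `[(1 / 2 : R), 1[%classic].

Lemma iter_rotation k z : iter k rot z = z * w ^+ k.
Proof.
by elim: k => [|k IH]; rewrite ?expr0 ?mulr1// iterS IH exprSr mulrA.
Qed.

Lemma whiskerP z : Y z <-> cmod z = 1 \/
  exists k x, [/\ (k < n.+1)%N, 1 / 2 <= x < 1 & z = x%:C%C * w ^+ k].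
Proof.
rewrite YE; split=> [[z1|[k /= kn [_ [x x12 <-] <-]]]|[z1|[k [x [kn x12 ->]]]]].
- by left; rewrite /cmod z1.
- right; exists k, x; split=> //.
  exact: iter_rotation.
- by left; rewrite /circle /= cmodE z1.
- right; exists k => //=; exists x%:C%C; last exact: iter_rotation.
  by exists x => //=; rewrite in_itv.
Qed.

Let ncwX k : cmod (w ^+ k) = 1.
Proof. by rewrite /cmod normrX (norm_expi (rot_angle p n.+1)) expr1n. Qed.

Lemma whisker_cmod z : Y z -> 1 / 2 <= cmod z <= 1.
Proof.
move=> /whiskerP[->|[k [x [_ /andP[x1 x2] ->]]]]; first by apply/andP; split; lra.
rewrite cmodM ncwX mulr1 cmod_real ger0_norm; last lra.
by apply/andP; split; lra.
Qed.

(** A whisker point may slide outward along its own whisker until it reaches the circle, and a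
    circle point only admits [m = 1]. *)
Lemma whisker_scale z m : Y z -> cmod z <= m <= 1 -> Y (z * (m / cmod z)%:C%C).
Proof.
move=> Yz /andP[zm m1]; have /andP[z12 z1] := whisker_cmod Yz.
have z0 : 0 < cmod z by lra.
have ncm : cmod (z * (m / cmod z)%:C%C) = m.
  rewrite cmodM cmod_real ger0_norm; first by rewrite mulrC divfK// gt_eqF.
  by apply: divr_ge0; lra.
apply/whiskerP; move: m1; rewrite le_eqVlt => /predU1P[m1|m1]; first by left; rewrite ncm.
move/whiskerP : Yz => [z1'|[k [x [kn /andP[x1 x2] zE]]]]; first by lra.
right; exists k, m; split=> //; first by apply/andP; split; lra.
have x0 : x != 0 by rewrite gt_eqF//; lra.
have -> : cmod z = x by rewrite zE cmodM ncwX mulr1 cmod_real ger0_norm//; lra.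
rewrite zE mulrAC; congr (_ * _); rewrite -rmorphM /=; congr (_%:C%C).
by rewrite mulrC divfK.
Qed.

(** The modulus after the push: raised to at least [1 / 2 + d] but cut off at 1. Points of [Y] stay
    fixed for [d <= 0] and end on the circle for [d >= 1 / 2], so every real [d] is a legitimate
    parameter. *)
Definition level (d : R) (z : C) : R := Num.min 1 (Num.max (cmod z) (1 / 2 + d)).

Definition push (d : R) (z : C) : C := z * (level d z / cmod z)%:C%C.

Lemma level_bounds d z : Y z -> cmod z <= level d z <= 1.
Proof.
move=> /whisker_cmod/andP[_ z1].
by rewrite /level ge_min lexx/= andbT le_min z1 le_max lexx.
Qed.

Lemma push_in d (z : Y) : push d (val z) \in Y.
Proof.
apply: mem_set; apply: whisker_scale; first exact: (set_valP z).
by apply: level_bounds; exact: (set_valP z).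
Qed.

Definition pushY (d : R) (z : Y) : Y := exist _ (push d (val z)) (push_in d z).

Lemma cmod_push d z : Y z -> cmod (push d z) = level d z.
Proof.
move=> Yz; have /andP[z12 _] := whisker_cmod Yz.
have /andP[zl _] := level_bounds d Yz.
have z0 : 0 < cmod z by lra.
rewrite /push cmodM cmod_real ger0_norm; first by rewrite mulrC divfK// gt_eqF.
by apply: divr_ge0; lra.
Qed.

Lemma pushY_continuous : continuous (fun dz : R * Y => pushY dz.1 dz.2).
Proof.
have cval : continuous (fun dz : R * Y => val dz.2).
  apply: (continuous_compose (f := fun dz : R * Y => dz.2) _ (@initial_continuous _ _ _)).
  by move=> dz; exact: cvg_snd.
have cnc : continuous (fun dz : R * Y => cmod (val dz.2)).
  exact: (continuous_compose cval (@continuous_cmod R)).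
have clev : continuous (fun dz : R * Y => level dz.1 (val dz.2)).
  move=> dz; refine (@continuous_min R (R * Y)%type (fun=> 1)
    (fun dz => Num.max (cmod (val dz.2)) (1 / 2 + dz.1)) dz _ _).
    exact: cvg_cst.
  refine (@continuous_max R (R * Y)%type (fun dz => cmod (val dz.2))
    (fun dz => 1 / 2 + dz.1) dz _ _); first exact: cnc.
  by apply: cvgD; [exact: cvg_cst|exact: cvg_fst].
apply: continuous_comp_initial => dz.
apply: cvgM; first exact: cval.
apply: cvg_complex; last exact: cvg_cst.
apply: cvgM; first exact: clev.
apply: cvgV; last exact: cnc.
(* The division is harmless because moduli on [Y] are at least [1 / 2]. *)
have /andP[z12 _] := whisker_cmod (set_valP dz.2).
by rewrite gt_eqF//; lra.
Qed.

Lemma pushY0 (z : Y) : pushY 0 z = z.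
Proof.
apply: val_inj => /=; rewrite /push /level.
have /andP[z12 z1] := whisker_cmod (set_valP z).
rewrite addr0 max_l// min_r// divff// ?rmorph1 ?mulr1//.
by rewrite gt_eqF//; lra.
Qed.

Local Notation phi := (homeo_restr rotY).

Lemma pushY_equivariant d (z : Y) : pushY d (phi z) = phi (pushY d z).
Proof.
apply: val_inj => /=; rewrite /push /level.
have -> : cmod (val z * expi (rot_angle p n.+1)) = cmod (val z) by rewrite cmodM cmod_expi mulr1.
by rewrite mulrAC.
Qed.

Lemma iter_homeo_restr k (z : Y) : val (iter k phi z) = val z * w ^+ k.
Proof. by rewrite -iter_rotation; elim: k => //= k ->. Qed.

Lemma tip_in : ((1 / 2 : R)%:C)%C \in Y.
Proof.
apply/mem_set/whiskerP; right; exists 0%N, (1 / 2); split=> //.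
  by apply/andP; split; lra.
by rewrite expr0 mulr1.
Qed.

Definition tip : Y := exist (fun z => z \in Y) _ tip_in.

Lemma bump_continuous (d : R) :
  continuous (fun z : Y => (Num.max (1 / 2 + d - cmod (val z)) 0)%:C%C).
Proof.
move=> z; have FF := nbhs_filter z; apply: cvg_complex; last exact: cvg_cst.
refine (@continuous_max R Y (fun z => 1 / 2 + d - cmod (val z)) (fun=> 0) z _ _);
  last exact: cvg_cst.
apply: cvgB; first exact: cvg_cst.
apply: (continuous_compose (f := fun z : Y => val z) _ (@continuous_cmod R)).
exact: initial_continuous.
Qed.

(** For small [d > 0] it is supported near the whisker tips. Pushing by [d] raises all moduli out of
    its support, provided that the cut-off at 1 is not below [1 / 2 + d]. *)
Definition bump d : continuousType Y C := mkcts (@bump_continuous d).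

Lemma bump_push d z : d <= 1 / 2 -> bump d (pushY d z) = 0.
Proof.
move=> d12; change ((Num.max (1 / 2 + d - cmod (push d (val z))) 0)%:C%C = 0 :> C).
rewrite cmod_push; last exact: (set_valP z).
rewrite max_r// subr_le0 /level le_min le_max lexx orbT andbT; lra.
Qed.

Lemma bump_tip d : 0 <= d -> bump d tip = d%:C%C.
Proof.
move=> d0; change ((Num.max (1 / 2 + d - cmod (1 / 2)%:C%C) 0)%:C%C = d%:C%C :> C).
rewrite cmod_real ger0_norm; last lra.
by rewrite addrAC subrr add0r max_l.
Qed.

End Whisker.

(** * The torus of representations and the contradiction at the tip *)

Section Final.
Context {R : realType} (p : int) (n : nat).
Local Notation C := R[i].
Local Notation CT := (continuousType (@circle R) C).
Hypothesis pn : coprimez p n.+1%:Z.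
Local Notation phi := (homeo_restr (@rotation_circle R p n.+1%:Z)).

Lemma circle_bounded (f : CT) : exists M, forall x, cmod (f x) <= M.
Proof. exact: (compact_cmod_bounded _ (compact_set_type (@compact_circle R))). Qed.

Lemma iter_rotation_circle k (z : @circle R) :
  val (iter k phi z) = val z * rot_mult p n ^+ k.
Proof. by rewrite -iter_rotation; elim: k => //= k ->. Qed.

Lemma rotation_circle_periodic (z : @circle R) : iter n.+1 phi z = z.
Proof.
apply: val_inj; rewrite iter_rotation_circle.
by rewrite (prim_expr_order (rot_mult_prim pn)) mulr1.
Qed.

Lemma diag_mxX (d : 'rV[C]_n.+1) m i : (diag_mx d ^+ m) i i = d 0 i ^+ m.
Proof.
elim: m => [|m IH]; first by rewrite !expr0 mxE eqxx.
by rewrite exprS -mulmxE mul_diag_mx mxE IH exprS.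
Qed.

Section Scalars.
Variables (B : cstarAlgType R) (iX : CT -> B) (iZ : int -> B).
Hypothesis cov : covariant_rep phi iX iZ.

(** Both powers are scalar for any such pair. Writing them as powers of unimodular eigenvalues
    supplies the initial phases for the torus of representations and shows that the scalars have
    modulus 1. *)
Lemma pt_scalars (K : ptopologicalType) (f : B -> matfam R K n) (k : K) :
  star_hom f -> exists s t : C, [/\ `|s| = 1, `|t| = 1,
    pt_rho iX f k zeta ^+ n.+1 = (s ^+ n.+1)%:M &
    pt_V iZ f k ^+ n.+1 = (t ^+ n.+1)%:M].
Proof.
move=> fh.
have Uu := zeta_unitary (pt_rhoM cov k fh) (pt_rhoC cov k fh) (pt_rhoJ cov k fh).
have Vu := pt_V_unitary cov k fh; have UV := pt_commute cov k fh.
have w_prim := rot_mult_prim (R := R) pn.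
have [s [x [xn Ux]]] := exists_unit_eigenvector (pt_rho iX f k zeta).
have [t [y [yn Vy]]] := exists_unit_eigenvector (pt_V iZ f k).
exists s, t; split.
- exact: (eigenvalue_norm Uu xn Ux).
- exact: (eigenvalue_norm Vu yn Vy).
- exact: (unitary_power_scalar w_prim Uu Vu UV xn Ux).
- have [mu VE] : exists mu, pt_V iZ f k ^+ n.+1 = mu%:M.
    by eexists; exact: (shift_power_scalar w_prim Uu Vu UV xn Ux).
  rewrite VE; congr (_%:M).
  have E m : pt_V iZ f k ^+ m *m y = t ^+ m *: y.
    elim: m => [|m IH]; first by rewrite !expr0 mul1mx scale1r.
    by rewrite exprSr -mulmxE -mulmxA Vy -scalemxAr IH scalerA exprS.
  have /eqP := E n.+1; rewrite VE mul_scalar_mx -subr_eq0 -scalerBl scaler_eq0.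
  case/orP; first by rewrite subr_eq0 => /eqP.
  by move=> /eqP y0; move: yn; rewrite y0 vnorm0 => /eqP; rewrite eq_sym oner_eq0.
Qed.

End Scalars.

Lemma sin_mul_gt0 (x : R) : -1 <= x <= 1 -> x != 0 -> 0 < x * sin x.
Proof.
have pos (y : R) : 0 < y -> y <= 1 -> 0 < y * sin y.
  move=> y0 y1; rewrite mulr_gt0// sin_gt0_pi// y0/=.
  by rewrite (le_lt_trans y1)// (lt_le_trans _ (pi_ge2 R))// ltr1n.
move=> /andP[x1 x2]; rewrite neq_lt => /orP[x0|x0]; last exact: pos.
by have := pos (- x); rewrite sinN mulrNN; apply; lra.
Qed.

Lemma sin_mul_ge0 (x : R) : -1 <= x <= 1 -> 0 <= x * sin x.
Proof.
move=> x1; have [->|x0] := eqVneq x 0; first by rewrite mul0r.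
exact/ltW/sin_mul_gt0.
Qed.

Lemma cos_gt0_unit (x : R) : -1 <= x <= 1 -> 0 < cos x.
Proof.
rewrite -ler_norml -cos_norm le_eqVlt => /predU1P[->|x1]; first exact: cos1_gt0.
have := pihalf_ge1 R; have := normr_ge0 x => x0 h1.
by apply: cos_gt0_pihalf; apply/andP; split; lra.
Qed.

(** After division by [a] and [b] the imaginary parts at [d = 0] are [sin x] and [sin y], which
    point outward on the unit circle. This survives for small [d], so they have a common zero in the
    disc. *)
Lemma near_torus_hits (H1 H2 : R * C -> C) (a b : C) :
  continuous H1 -> continuous H2 -> `|a| = 1 -> `|b| = 1 ->
  (forall k, `|H1 k| = 1) -> (forall k, `|H2 k| = 1) ->
  (forall z, H1 (0, z) = a * expi (complex.Re z)) ->
  (forall z, H2 (0, z) = b * expi (complex.Im z)) ->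
  exists d z, [/\ 0 < d, d <= 1 / 2, H1 (d, z) = a & H2 (d, z) = b].
Proof.
move=> cH1 cH2 a1 b1 H1n H2n H10 H20.
pose F1 k := H1 k * conjc a; pose F2 k := H2 k * conjc b.
have F1E z : F1 (0, z) = expi (complex.Re z).
  by rewrite /F1 H10 mulrAC cmod_unimodular// mul1r.
have F2E z : F2 (0, z) = expi (complex.Im z).
  by rewrite /F2 H20 mulrAC cmod_unimodular// mul1r.
have cF1 : continuous F1 by move=> k; apply: cvgM; [exact: cH1|exact: cvg_cst].
have cF2 : continuous F2 by move=> k; apply: cvgM; [exact: cH2|exact: cvg_cst].
pose G (d : R) (z : C) := (complex.Im (F1 (d, z)) +i* complex.Im (F2 (d, z)))%C.
have cI1 := continuous_compose cF1 (@continuous_Im R).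
have cI2 := continuous_compose cF2 (@continuous_Im R).
have bounds (z : C) : cmod z <= 1 ->
    -1 <= complex.Re z <= 1 /\ -1 <= complex.Im z <= 1.
  move=> z1; rewrite -!ler_norml; split.
    exact: le_trans (cmod_Re z) z1.
  exact: le_trans (cmod_Im z) z1.
(* A vanishing imaginary part leaves the values 1 and -1; positive real parts will exclude -1. *)
have n1 : \forall d \near (0 : R), forall z, cmod z <= 1 -> 0 < complex.Re (F1 (d, z)).
  apply: (near_pos_compact (continuous_compose cF1 (@continuous_Re R)) (@compact_disc R)) => z z1.
  by rewrite /= F1E /=; apply: cos_gt0_unit; case: (bounds z z1).
have n2 : \forall d \near (0 : R), forall z, cmod z <= 1 -> 0 < complex.Re (F2 (d, z)).
  apply: (near_pos_compact (continuous_compose cF2 (@continuous_Re R)) (@compact_disc R)) => z z1.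
  by rewrite /= F2E /=; apply: cos_gt0_unit; case: (bounds z z1).
(* This is the hypothesis of [winding_zero] written out in coordinates; at [d = 0] it reads
   [x sin x + y sin y > 0]. *)
have n3 : \forall d \near (0 : R), forall z, circle z ->
    0 < complex.Im (F1 (d, z)) * complex.Re z + complex.Im (F2 (d, z)) * complex.Im z.
  apply: (@near_pos_compact R R C (fun k => complex.Im (F1 k) * complex.Re k.2 +
    complex.Im (F2 k) * complex.Im k.2) _ 0 _ (@compact_circle R)).
    have cs : continuous (snd : R * C -> C) by move=> k; exact: cvg_snd.
    have cR2 := continuous_compose cs (@continuous_Re R); have cI := continuous_compose cs (@continuous_Im R).
    move=> k; apply: cvgD; apply: cvgM;
      [exact: cI1|exact: cR2|exact: cI2|exact: cI].
  move=> z z1 /=; rewrite F1E F2E /= mulrC [X in _ + X]mulrC.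
  have ncz : cmod z = 1 by rewrite /cmod z1.
  have [xb yb] : -1 <= complex.Re z <= 1 /\ -1 <= complex.Im z <= 1.
    by apply: bounds; rewrite ncz.
  have [x0|x0] := eqVneq (complex.Re z) 0; last first.
    by rewrite ltr_wpDr ?sin_mul_ge0 ?sin_mul_gt0.
  rewrite x0 mul0r add0r sin_mul_gt0//; apply/eqP => y0.
  have := cmod_sqrE z; rewrite ncz x0 y0 expr0n addr0 expr1n => /eqP.
  by rewrite oner_eq0.
have [e e0 he] : exists2 e : R, 0 < e & forall d, `|d| < e ->
    [/\ forall z, cmod z <= 1 -> 0 < complex.Re (F1 (d, z)),
        forall z, cmod z <= 1 -> 0 < complex.Re (F2 (d, z)) &
        forall z, circle z -> 0 < complex.Im (F1 (d, z)) * complex.Re z +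
          complex.Im (F2 (d, z)) * complex.Im z].
  have [e /= e0 he] := filterI n1 (filterI n2 n3).
  exists e => // d de; have [|h1 [h2 h3]] := he d; last by split.
  by rewrite /ball_ /= sub0r normrN.
(* Halving [e] keeps [d] strictly inside the good range; the bound [1 / 2] is what [bump_push]
   requires. *)
pose d := Num.min (e / 2) (1 / 2).
have d0 : 0 < d by rewrite /d lt_min !divr_gt0.
have de : `|d| < e.
  rewrite gtr0_norm//; apply: (@le_lt_trans _ _ (e / 2)).
    by rewrite /d ge_min lexx.
  by lra.
have d12 : d <= 1 / 2 by rewrite /d ge_min lexx orbT.
have [h1 h2 h3] := he d de.
have cG : continuous (G d).
  have cd := @continuous_pairr R C d.
  move=> z; have FF := nbhs_filter z; apply: cvg_complex.
    exact: (continuous_compose cd cI1).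
  exact: (continuous_compose cd cI2).
have [z z1 Gz] : exists2 z, cmod z <= 1 & G d z = 0.
  apply: (winding_zero cG) => z z1; rewrite /G.
  have := h3 z z1; case: z z1 => x y _ /=.
  by rewrite !mulrN opprK.
have final (u c : C) : `|u| = 1 -> `|c| = 1 -> complex.Im (u * conjc c) = 0 ->
    0 < complex.Re (u * conjc c) -> u = c.
  move=> u1 c1 im0 re0.
  have : u * conjc c = 1.
    have := cmod_sqrE (u * conjc c); rewrite im0 expr0n addr0.
    rewrite cmodM cmod_conj /cmod u1 c1 mulr1 expr1n => e1.
    rewrite [LHS]complexE im0 mulr0 addr0.
    suff -> : complex.Re (u * conjc c) = 1 by [].
    by apply: (@pexpIrn _ 2); rewrite ?nnegrE ?ltW// expr1n.
  move=> /(congr1 ( *%R^~ c)); rewrite mul1r -mulrA [conjc c * c]mulrC.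
  by rewrite cmod_unimodular// mulr1.
exists d, z; move: Gz => [G1 G2]; split=> //.
  by apply: final => //; exact: h1.
by apply: final => //; exact: h2.
Qed.

Section NotIsomorphic.
Variable Y : set C.
Hypothesis rotY : rotation p n.+1%:Z @` Y = Y.
Hypothesis YE : Y = @circle R `|`
  \bigcup_(k in [set k : nat | (k%:Z < n.+1%:Z)%R])
    iter k (rotation p n.+1%:Z) @` [set (x%:C)%C | x in `[(1 / 2 : R), 1[%classic].
Hypothesis cY : compact Y.
Local Notation phiY := (homeo_restr rotY).
Local Notation CY := (continuousType Y C).

Lemma whisker_periodic (z : Y) : iter n.+1 phiY z = z.
Proof.
apply: val_inj; rewrite (iter_homeo_restr rotY).
by rewrite (prim_expr_order (rot_mult_prim pn)) mulr1.
Qed.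

Lemma whisker_not_isomorphic (A B : cstarAlgType R) :
  is_crossed_product phiY A -> is_crossed_product phi B -> ~ cstar_isomorphic A B.
Proof.
move=> [iXA [iZA [covA univA]]] [iXB [iZB [covB univB]]] [g [gh [g' gK g'K]]].
have g'h := star_hom_can gK g'K gh.
have bndY (f : CY) := compact_cmod_bounded f (compact_set_type cY).
have cone (K : ptopologicalType) : continuous (fun _ : K => 1 : C).
  by move=> k; exact: cvg_cst.
(* The tip representation of [A], seen as a constant family; the parameter space [R] is a dummy. *)
have [pi0 [[pi0h pi0X _] _]] := univA _ _ _ (orbit_covariant whisker_periodic bndY
  (K := R) (gam := fun=> tip YE) (t := fun=> 1) (fun k => cvg_cst _) (cone R)
  (fun=> normr1 _)).
pose f2 : B -> matfam R R n := pi0 \o g'.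
have f2h : star_hom f2 := star_hom_comp g'h pi0h.
have [s0 [t0 [s1 t1 U2 V2]]] := pt_scalars covB 0 f2h.
have sE x : `|s0 * expi x| = 1 by rewrite normrM s1 norm_expi mulr1.
have tE x : `|t0 * expi x| = 1 by rewrite normrM t1 norm_expi mulr1.
(* The division by [n.+1] compensates the [n.+1]-th powers in the scalars, which then turn exactly
   by [Re z] and [Im z]. *)
pose gam (z : C) : @circle R := circle_elt (sE (complex.Re z / n.+1%:R)).
pose t (z : C) : C := t0 * expi (complex.Im z / n.+1%:R).
have cexp (h : C -> R) : continuous h ->
    continuous (fun z => expi (h z / n.+1%:R)).
  move=> ch; apply: (continuous_compose (f := fun z => h z / n.+1%:R) _ (@continuous_expi R)).
  by move=> z; have FF := nbhs_filter z; apply: cvgM; [exact: ch|exact: cvg_cst].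
have cgam : continuous gam.
  apply: continuous_comp_initial => z; have FF := nbhs_filter z.
  by apply: cvgM; [exact: cvg_cst|exact: (cexp _ (@continuous_Re R))].
have ct : continuous t.
  move=> z; have FF := nbhs_filter z.
  by apply: cvgM; [exact: cvg_cst|exact: (cexp _ (@continuous_Im R))].
have [Pi [[Pih PiX PiZ] _]] := univB _ _ _ (orbit_covariant
  rotation_circle_periodic circle_bounded cgam ct (fun z => tE _)).
have Pg : star_hom (Pi \o g) := star_hom_comp gh Pih.
(* The torus of representations is pulled back to [A], where the whiskers can be pushed, and [f1]
   carries the deformed family back to [B]; at [d = 0] it is [Pi] again. *)
have [Th [Thh Th0 ThX]] := homotopy_extension (compact_set_type cY)
  (pushY_continuous (YE := YE)) (pushY0 YE) (pushY_equivariant rotY YE) covA univA Pg.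
pose f1 : B -> matfam R (R * C)%type n := Th \o g'.
have f1h : star_hom f1 := star_hom_comp g'h Thh.
pose H1 k := (pt_rho iXB f1 k zeta ^+ n.+1) 0 0.
pose H2 k := (pt_V iZB f1 k ^+ n.+1) 0 0.
have powE (b : B) m k : (f1 (b ^+ m) : matfam R (R * C)%type n) k =
    (f1 b : matfam R (R * C)%type n) k ^+ m.
  rewrite (homX f1h); elim: m => [|m IH]; first by rewrite !expr0.
  by rewrite !exprS matfamME IH.
have cH1 : continuous H1.
  rewrite (_ : H1 = fun k => f1 (iXB zeta ^+ n.+1) k 0 0).
    exact: matfam_continuous.
  by apply/funext => k; rewrite powE.
have cH2 : continuous H2.
  rewrite (_ : H2 = fun k => f1 (iZB 1 ^+ n.+1) k 0 0).
    exact: matfam_continuous.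
  by apply/funext => k; rewrite powE.
have H1n k : `|H1 k| = 1.
  have [s [t' [s1' _ E _]]] := pt_scalars covB k f1h.
  by rewrite /H1 E mxE mulr1n normrX s1' expr1n.
have H2n k : `|H2 k| = 1.
  have [s [t' [_ t1' _ E]]] := pt_scalars covB k f1h.
  by rewrite /H2 E mxE mulr1n normrX t1' expr1n.
have f10 b z : f1 b (0, z) = (Pi b : matfam R C n) z by rewrite /f1 /= Th0 /= g'K.
have expn x : expi (x / n.+1%:R) ^+ n.+1 = expi x.
  by rewrite -expiMn -(mulr_natr (x / n.+1%:R)) divfK// pnatr_eq0.
have H10 z : H1 (0, z) = s0 ^+ n.+1 * expi (complex.Re z).
  rewrite /H1 /pt_rho f10 PiX orbit_diagE diag_mxX mxE /=.
  by rewrite exprMn expn.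
have H20 z : H2 (0, z) = t0 ^+ n.+1 * expi (complex.Im z).
  rewrite /H2 /pt_V f10 PiZ zpow1 orbit_shiftX mxE mulr1n.
  by rewrite exprMn expn.
have sX : `|s0 ^+ n.+1| = 1 by rewrite normrX s1 expr1n.
have tX : `|t0 ^+ n.+1| = 1 by rewrite normrX t1 expr1n.
have [d [z [d0 d12 H1E H2E]]] := near_torus_hits cH1 cH2 sX tX H1n H2n H10 H20.
have f1b : f1 (g (iXA (bump Y d))) (d, z) = 0.
  rewrite /f1 /= gK ThX.
  rewrite (_ : homotope _ _ _ = 0); first by rewrite (covariant_rep0 covA) (hom0 Pg).
  by apply/continuousEP => y; exact: bump_push.
(* At [(d, z)] the deformed family has the scalars of the tip representation, so the vanishing
   transfers to the latter, whose first diagonal entry on the bump is [d > 0]. *)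
have : f2 (g (iXA (bump Y d))) 0 = 0.
  apply: (kernel_of_scalars pn covB univB (k1 := (d, z)) f1h f2h) f1b.
    by rewrite -/(H1 _) H1E U2 mxE mulr1n.
  by rewrite -/(H2 _) H2E V2 mxE mulr1n.
rewrite /f2 /= gK pi0X orbit_diagE.
move=> /(congr1 (fun M : 'M[C]_n.+1 => M 0 0)); rewrite !mxE eqxx mulr1n.
rewrite [X in X = _](bump_tip YE (ltW d0)) => /(congr1 (@complex.Re R)) /= dE.
by rewrite dE ltxx in d0.
Qed.
End NotIsomorphic.

End Final.

Theorem mainTheorem10 (R : realType) (p q : int)
  (coprime_pq : coprimez p q) (q_gt0 : 0 < q)
  (psi : continuousType (@circle R) R[i])
  (psi_not_injective : ~ injective psi)
  (toeplitz_irreducible : irreducible_op (toeplitz psi))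
  (rotation_range : rotation p q @` range psi = range psi)
  (range_psiE : range psi =
     @circle R `|`
     \bigcup_(n in [set n : nat | (n%:Z < q)%R])
       iter n (rotation p q) @` [set (x%:C)%C | x in `[(1 / 2 : R), 1[%classic])
  (A B : cstarAlgType R)
  (A_crossed : is_crossed_product (homeo_restr rotation_range) A)
  (B_crossed : is_crossed_product (homeo_restr (@rotation_circle R p q)) B) :
  ~ cstar_isomorphic A B.
Proof.
have cY : compact (range psi).
  apply: continuous_compact (compact_set_type (@compact_circle R)).
  by apply: continuous_subspaceT; exact: cts_fun.
case: q coprime_pq q_gt0 rotation_range range_psiE A_crossed B_crossed => [[//|n]|//].
move=> pn _ rotY YE; exact: whisker_not_isomorphic.
Qed.
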